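(* Let $X$ be a finite-dimensional real or complex inner product space (Hermitian in the complex case). For any blades $A,B\in\bigwedge X$, $$\langle A,B\rangle=\|A\|\|B\|\cos\hat\Theta_{A,B}.$$
   Context: $X$ is real Euclidean or complex with Hermitian product $\langle\cdot,\cdot\rangle$, conjugate-linear in the first argument. $\bigwedge X$ has the induced inner product ($\langle v_1\wedge\cdots\wedge v_p,w_1\wedge\cdots\wedge w_p\rangle=\det(\langle v_i,w_j\rangle)$, different grades being orthogonal) and norm $\|\cdot\|$. A $p$-blade ($p\ge1$) is $A=v_1\wedge\cdots\wedge v_p$; if $A\neq0$, $[A]=\mathrm{span}(v_1,\ldots,v_p)$. Scalars are $0$-blades with $[A]=\{0\}$; $[0]=\{0\}$. Principal bases: for subspaces $V,W$ of dimensions $p,q$, with $m=\min\{p,q\}$, the principal angles $0\le\theta_1\le\cdots\le\theta_m\le\frac\pi2$ and associated principal bases (orthonormal bases) $(e_1,\ldots,e_p)$ of $V$ and $(f_1,\ldots,f_q)$ of $W$ satisfy $\langle e_i,f_j\rangle=\delta_{ij}\cos\theta_i$ for all $i\le p,j\le q$ (the basis of $\{0\}$ is empty). Relative orientation: for nonzero blades $A,B$ of grades $p,q$, with associated principal bases $(e_i)$, $(f_j)$ of $[A],[B]$, write $A=\epsilon_A\|A\|e_1\wedge\cdots\wedge e_p$ and $B=\epsilon_B\|B\|f_1\wedge\cdots\wedge f_q$, where $\epsilon_A,\epsilon_B$ are scalars of modulus $1$ ($\pm1$ in the real case). Then $\epsilon_{A,B}=\bar\epsilon_A\epsilon_B$.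 Angles: for subspaces $V,W$, let $k$ be the real dimension of $V$ (i.e. $k=\dim V$ in the real case, $k=2\dim_{\mathbb C}V$ in the complex case), $P_W$ the orthogonal projection onto $W$, $S\subset V$ a non-degenerate $k$-dimensional parallelotope, and $\pi_{V,W}=\frac{\mathrm{vol}_k(P_W(S))}{\mathrm{vol}_k(S)}$ ($\mathrm{vol}_0$ of a point is $1$). The asymmetric angle $\Theta_{V,W}\in[0,\frac\pi2]$ is given by $\cos\Theta_{V,W}=\pi_{V,W}$ in the real case, and $\cos^2\Theta_{V,W}=\pi_{V,W}$ in the complex case. The max-symmetrized angle is $\hat\Theta_{V,W}=\max\{\Theta_{V,W},\Theta_{W,V}\}$. The oriented max-symmetrized angle $\hat\Theta_{A,B}$ (in $[0,\pi]$ in the real case, complex-valued in the complex case) is given by $\cos\hat\Theta_{A,B}=\epsilon_{A,B}\cos\hat\Theta_{[A],[B]}$, for any choice of associated principal bases. If $A=0$ or $B=0$, the right-hand side of the claim is read as $0$. *)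

(* Defs.v *)
From mathcomp Require Import all_boot all_order all_algebra.
From mathcomp Require Import sesquilinear complex.
From mathcomp Require Import all_classical all_reals all_analysis.

Set Implicit Arguments.
Unset Strict Implicit.
Unset Printing Implicit Defensive.

Import Order.TTheory GRing.Theory Num.Theory Num.Def.
Import numFieldNormedType.Exports.

Local Open Scope classical_set_scope.
Local Open Scope ring_scope.

(* Common interface to the two scalar fields below, the only ones used; [rdim]
   is the dimension of the field over R. *)
Record scalars (R : realType) := Scalars {
  scalar :> numFieldType;
  sconj : {rmorphism scalar -> scalar};
  of_real : R -> scalar;
  re_part : scalar -> R;
  rdim : nat }.

Definition real_scalars (R : realType) : scalars R :=
  @Scalars R R idfun idfun idfun 1.

Definition complex_scalars (R : realType) : scalars R :=
  @Scalars R R[i] conjC (real_complex R) (@complex.Re R) 2.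

Section InnerProductSpace.
Variables (R : realType) (F : scalars R) (X : vectType F).
Variable g : {dot X for sconj F}.

(* The library's forms are linear in the first argument and conjugate-linear
   in the second one, hence the swap. *)
Definition ip (u v : X) : F := g v u.

Definition gram_det (s t : seq X) : F :=
  \det (\matrix_(i < size s, j < size s) ip s`_i t`_j).

(* A parallelotope is given, up to translation, by its edge vectors, which are
   independent over R when it is non-degenerate. Its volume is that of the real
   Euclidean space X with inner product Re <u, v>: the square root of the Gram
   determinant of the edges (1 if there are none). *)
Definition vol (s : seq X) : R :=
  Num.sqrt (\det (\matrix_(i < size s, j < size s) re_part (ip s`_i s`_j))).

Definition rfree (s : seq X) : Prop :=
  forall c : 'I_(size s) -> R,
    \sum_(i < size s) of_real F (c i) *: s`_i = 0 -> forall i, c i = 0.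

Definition orth_proj (W : {vspace X}) : X -> X := daddv_pi W (orthov g W).

(* rdim F * \dim V is the real dimension of V. The volume ratio is cos th over
   the reals and cos th ^+ 2 over the complex numbers. *)
Definition is_asym_angle (V W : {vspace X}) (th : R) : Prop :=
  0 <= th <= pi / 2 /\
  forall S : (rdim F * \dim V).-tuple X,
    {subset S <= V} -> rfree S ->
    cos th ^+ rdim F = vol [seq orth_proj W v | v <- S] / vol S.

Definition asym_angle (V W : {vspace X}) : R :=
  xget 0 [set th : R | is_asym_angle V W th].

Definition max_angle (V W : {vspace X}) : R :=
  Num.max (asym_angle V W) (asym_angle W V).

Definition principal_bases (V W : {vspace X}) (e f : seq X) : Prop :=
  exists theta : seq R,
    [/\ size theta = minn (\dim V) (\dim W),
        sorted <=%R theta & {in theta, forall t : R, 0 <= t <= pi / 2}] /\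
    [/\ basis_of V e /\ orthonormal g e,
        basis_of W f /\ orthonormal g f &
        forall i j, (i < \dim V)%N -> (j < \dim W)%N ->
          ip e`_i f`_j = if i == j then of_real F (cos theta`_i) else 0].

(* The exterior algebra in coordinates: A S is the coefficient of the product
   b_S, in increasing order of i, of the b_i with i in S, where (b_i) is the
   basis vbasis {:X} of X (not orthonormal in general). *)
Definition ext : Type := {ffun {set 'I_(\dim {:X})} -> F^o}.

(* b_S ^ b_T is (-1) ^+ ext_inv S T times the product b_(S :|: T) if S and T
   are disjoint, and 0 otherwise. *)
Definition ext_inv (S T : {set 'I_(\dim {:X})}) : nat :=
  #|[set st in finset.setX S T | (st.2 < st.1)%N]|.

Definition ext_mul (A B : ext) : ext :=
  [ffun U : {set _} => \sum_(S in powerset U)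
     (-1) ^+ ext_inv S (U :\: S)%SET * A S * B (U :\: S)%SET].

Definition ext_scalar (c : F) : ext :=
  [ffun S : {set _} => if S == finset.set0 then c else 0].

Definition ext_vector (v : X) : ext :=
  [ffun S : {set _} => \sum_(i | S == [set i]%SET) coord (vbasis {:X}) i v].

Definition wedge (s : seq X) : ext :=
  foldr (fun v A => ext_mul (ext_vector v) A) (ext_scalar 1) s.

Definition ext_basis (S : {set 'I_(\dim {:X})}) : seq X :=
  [seq (vbasis {:X})`_i | i : 'I_(\dim {:X}) <- enum S].

(* The sesquilinear form such that <b_S, b_T> is the determinant of the
   <b_i, b_j>, i in S and j in T, if S and T have the same cardinality and 0
   otherwise; this is the induced inner product, as the b_S are a basis. *)
Definition ext_ip (A B : ext) : F :=
  \sum_(S : {set _}) \sum_(T : {set _} | #|T| == #|S|)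
     sconj F (A S) * B T * gram_det (ext_basis S) (ext_basis T).

Definition ext_norm (A : ext) : R := Num.sqrt (re_part (ext_ip A A)).

Definition is_blade (A : ext) : Prop :=
  (exists c : F, A = ext_scalar c) \/
  (exists2 v : seq X, (0 < size v)%N & A = wedge v).

(* 0%VS for scalars and for 0, the span of the factors otherwise. *)
Definition blade_space (A : ext) : {vspace X} :=
  xget 0%VS [set V | A != 0 /\
    exists2 v : seq X, (0 < size v)%N & A = wedge v /\ V = <<v>>%VS].

(* The unit scalar epsilon_A such that A = epsilon_A ||A|| e_1 ^ .. ^ e_p. *)
Definition orientation (A : ext) (e : seq X) : F :=
  xget 1 [set z : F | `|z| = 1 /\ A = (z * of_real F (ext_norm A)) *: wedge e].

Definition rel_orientation (A B : ext) (e f : seq X) : F :=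
  sconj F (orientation A e) * orientation B f.

End InnerProductSpace.

Section RealAngle.
Variables (R : realType) (X : vectType (real_scalars R)).
Variable g : {dot X for sconj (real_scalars R)}.

Definition real_oriented_angle (A B : ext X) : R :=
  xget 0 [set phi : R | 0 <= phi <= pi /\
    forall e f : seq X,
      principal_bases g (blade_space A) (blade_space B) e f ->
      cos phi = rel_orientation g A B e f
                * cos (max_angle g (blade_space A) (blade_space B))].

End RealAngle.

Section ComplexAngle.
Variable R : realType.
Local Open Scope complex_scope.

Definition cexp (z : R[i]) : R[i] :=
  (expR (complex.Re z))%:C * (cos (complex.Im z) +i* sin (complex.Im z)).

Definition ccos (z : R[i]) : R[i] := (cexp ('i * z) + cexp (- ('i * z))) / 2.

Variable X : vectType (complex_scalars R).
Variable g : {dot X for sconj (complex_scalars R)}.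

(* Only ccos of this angle is determined. *)
Definition complex_oriented_angle (A B : ext X) : R[i] :=
  xget 0 [set phi : R[i] |
    forall e f : seq X,
      principal_bases g (blade_space A) (blade_space B) e f ->
      ccos phi = rel_orientation g A B e f
                 * (cos (max_angle g (blade_space A) (blade_space B)))%:C].

End ComplexAngle.

(* Main.v *)
Require Import Defs.
From mathcomp Require Import all_boot all_order all_fingroup all_algebra.
From mathcomp Require Import ring.
From mathcomp Require Import sesquilinear complex.
From mathcomp Require Import all_classical all_reals all_analysis.

(** Both sides are computed in principal bases.  Expanding along the first row
    shows that the coordinates of v_1 ^ .. ^ v_p are the p x p minors of the
    coordinate matrix of the v_i, so two applications of the Cauchy-Binet formula
    identify the sesquilinear form on the exterior algebra with the Gram
    determinant on blades.  If (e_i) and (f_j) are associated principal bases, a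
    nonzero blade A is a multiple of e_1 ^ .. ^ e_p, and <A, B> becomes
    ||A|| ||B|| epsilon_{A,B} times the product of the cos theta_i (or 0 if the
    grades differ).
    On the other side, P_W e_i = cos theta_i f_i (or 0 if i > dim W), hence in an
    orthonormal basis of V over the reals the Gram matrix of a projected
    parallelotope is M D M^T with D diagonal; the factor det M cancels in the
    volume ratio, which leaves the product of the cos theta_i to the power
    rdim F, and 0 if dim V > dim W, so that the larger of the two angles is
    pi / 2 when the grades differ.
    Principal bases exist because the form <P_W u, P_W v> on V is diagonal in
    some orthonormal basis of V; the f_i are the normalized nonzero P_W e_i,
    completed to a basis of W. *)

Set Implicit Arguments.
Unset Strict Implicit.
Unset Printing Implicit Defensive.

Import Order.TTheory GRing.Theory Num.Theory Num.Def.
Import numFieldNormedType.Exports.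

Local Open Scope ring_scope.

(** * The Cauchy-Binet formula *)

Section CauchyBinet.
Variable K : comNzRingType.

(** The number p of columns is a parameter independent of [#|T|], so that no cast along an equality
    of cardinals enters the statements; columns past [#|T|] get the default value 0. *)
Definition sel_cols m n p (A : 'M[K]_(m, n)) (T : {set 'I_n}) : 'M[K]_(m, p) :=
  \matrix_(i, j) [seq A i k | k <- enum T]`_j.

Definition sel_rows m n p (A : 'M[K]_(n, m)) (T : {set 'I_n}) : 'M[K]_(p, m) :=
  \matrix_(i, j) [seq A k j | k <- enum T]`_i.

Lemma sel_rowsE m n p (A : 'M[K]_(n, m)) (T : {set 'I_n}) :
  sel_rows p A T = (sel_cols p A^T T)^T.
Proof.
apply/matrixP => i j; rewrite !mxE; congr nth.
by apply: eq_map => k; rewrite mxE.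
Qed.

Lemma sel_colsE m n p (A : 'M[K]_(m, n)) (T : {set 'I_n}) (pT : p = #|T|) :
  sel_cols p A T = colsub (fun j => enum_val (cast_ord pT j)) A.
Proof.
apply/matrixP => i j; rewrite !mxE (nth_map (enum_val (cast_ord pT j))).
  by congr (A i _); apply/esym/enum_val_nth.
by rewrite -cardE -pT.
Qed.

Lemma sel_cols_mul m n p q (A : 'M[K]_(m, p)) (B : 'M[K]_(p, n)) (T : {set 'I_n}) :
  sel_cols q (A *m B) T = A *m sel_cols q B T.
Proof.
apply/matrixP => i j; rewrite !mxE.
have [jT|jT] := ltnP j (size (enum T)).
  have [x0 _] : exists x0 : 'I_n, x0 \in enum T.
    by case: (enum T) jT => // x s _; exists x; rewrite mem_head.
  rewrite (nth_map x0) // mxE; apply: eq_bigr => k _.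
  by rewrite mxE (nth_map x0).
rewrite nth_default ?size_map // big1 // => k _.
by rewrite mxE nth_default ?size_map ?mulr0.
Qed.

Lemma sel_rows_mul m n p q (A : 'M[K]_(n, p)) (B : 'M[K]_(p, m)) (T : {set 'I_n}) :
  sel_rows q (A *m B) T = sel_rows q A T *m B.
Proof. by rewrite !sel_rowsE trmx_mul sel_cols_mul trmx_mul trmxK. Qed.

Lemma sel_rows_cols m n p q (A : 'M[K]_(m, n)) (S : {set 'I_m}) (T : {set 'I_n}) :
  sel_rows q (sel_cols p A T) S = sel_cols p (sel_rows q A S) T.
Proof.
by rewrite -[A in LHS]mulmx1 sel_cols_mul sel_rows_mul -sel_cols_mul mulmx1.
Qed.

(** Multilinearity in the rows: row i of [A *m B] is a combination of the rows of B, and f records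
    which row of B is chosen for each i. *)
Lemma det_mulmx_ffun n p (A : 'M[K]_(p, n)) (B : 'M[K]_(n, p)) :
  \det (A *m B) = \sum_(f : {ffun 'I_p -> 'I_n})
     (\prod_i A i (f i)) * \det (rowsub f B).
Proof.
transitivity (\sum_(f : {ffun 'I_p -> 'I_n}) \sum_(s : 'S_p)
    (-1) ^+ s * \prod_i (A i (f i) * B (f i) (s i))).
  rewrite exchange_big; apply: eq_bigr => /= s _; rewrite -big_distrr /=.
  congr (_ * _); rewrite -(bigA_distr_bigA (fun i j => A i j * B j (s i))) /=.
  by apply: eq_bigr => x _; rewrite mxE.
apply: eq_bigr => f _; rewrite /determinant mulr_sumr; apply: eq_bigr => s _.
rewrite mulrCA big_split /=; congr (_ * (_ * _)).
by apply: eq_bigr => i _; rewrite mxE.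
Qed.

(** The injective f with image T are the composites of a permutation s with the increasing
    enumeration e of T. Reordering the rows of B produces the sign of s, and the sum over s becomes
    the Leibniz formula for the minor of A. *)
Lemma det_sel_reindex n p (A : 'M[K]_(p, n)) (B : 'M[K]_(n, p)) (T : {set 'I_n}) :
  #|T| = p ->
  \sum_(f : {ffun 'I_p -> 'I_n} | injectiveb f && ([set f i | i : 'I_p] == T))
     (\prod_i A i (f i)) * \det (rowsub f B)
  = \det (sel_cols p A T) * \det (sel_rows p B T).
Proof.
move=> /esym pT; pose e j := enum_val (cast_ord pT j).
have eI : injective e by move=> i j /enum_val_inj /cast_ord_inj.
pose h (s : 'S_p) : {ffun 'I_p -> 'I_n} := [ffun i => e (s i)].
have hI : injective h.
  move=> s t /ffunP st; apply/permP => i.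
  by have := st i; rewrite !ffunE => /eI.
rewrite (eq_bigl (mem (h @: [set: 'S_p])%SET)); last first.
  move=> f /=; apply/andP/imsetP => [[/injectiveP fI /eqP fT]|[s _ ->]].
    have fe i : exists j, e j == f i.
      have fiT : f i \in T by rewrite -fT imset_f.
      exists (cast_ord (esym pT) (enum_rank_in fiT (f i))).
      by rewrite /e cast_ordKV enum_rankK_in.
    pose s0 i := xchoose (fe i).
    have s0E i : e (s0 i) = f i by apply/eqP; apply: (xchooseP (fe i)).
    have s0I : injective s0 by move=> i j ij; apply: fI; rewrite -!s0E ij.
    exists (perm s0I); first by rewrite inE.
    by apply/ffunP => i; rewrite ffunE permE s0E.
  split; first by apply/injectiveP => i j; rewrite !ffunE => /eI /perm_inj.
  rewrite eqEcard -pT card_imset ?card_ord; last first.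
    by move=> i j; rewrite !ffunE => /eI /perm_inj.
  rewrite leqnn andbT; apply/fintype.subsetP => _ /imsetP[i _ ->].
  by rewrite ffunE enum_valP.
rewrite big_imset /=; last by move=> s t _ _ /hI.
rewrite [\det (sel_cols _ _ _)]/determinant mulr_suml.
apply: eq_big => [s|s _]; first by rewrite inE.
have -> : rowsub (h s) B = row_perm s (sel_rows p B T).
  rewrite sel_rowsE (sel_colsE _ pT); apply/matrixP => i j.
  by rewrite !mxE ffunE.
rewrite row_permE det_mulmx det_perm mulrA [_ * (-1) ^+ s]mulrC.
congr (_ * _ * _).
by apply: eq_bigr => i _; rewrite (sel_colsE _ pT) mxE ffunE.
Qed.

Theorem Cauchy_Binet n p (A : 'M[K]_(p, n)) (B : 'M[K]_(n, p)) :
  \det (A *m B) = \sum_(T : {set 'I_n} | #|T| == p)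
     \det (sel_cols p A T) * \det (sel_rows p B T).
Proof.
rewrite det_mulmx_ffun (bigID (fun f : {ffun 'I_p -> 'I_n} => injectiveb f)) /=.
(* A non-injective f selects the same row of B twice; the injective ones are then grouped by their
   image. *)
rewrite addrC big1 ?add0r; last first.
  move=> f /injectivePn[i [j ij fij]]; rewrite (determinant_alternate ij) ?mulr0 //.
  by move=> k; rewrite !mxE fij.
rewrite (partition_big (fun f : {ffun 'I_p -> 'I_n} => [set f i | i : 'I_p])
  (fun T => #|T| == p)) /=.
  by apply: eq_bigr => T /eqP; apply: det_sel_reindex.
by move=> f /injectiveP fI; rewrite card_imset // card_ord.
Qed.

End CauchyBinet.

(** * Coordinates of exterior products *)

Section EnumOrdinal.
Variable n : nat.
Implicit Types (U : {set 'I_n}) (i : 'I_n).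

Lemma enum_setD1 U i : enum (U :\ i)%SET = rem i (enum U).
Proof.
rewrite rem_filter ?enum_uniq // /enum_mem -filter_predI.
by apply: eq_filter => k; rewrite /= !inE.
Qed.

(** Removing the j-th element of U skips the index j, exactly as [lift] does for the columns of a
    cofactor. *)
Lemma nth_enum_setD1 (x0 : 'I_n) U j k : (j < #|U|)%N ->
  nth x0 (enum (U :\ nth x0 (enum U) j)%SET) k = nth x0 (enum U) (bump j k).
Proof.
move=> jU; rewrite enum_setD1 remE index_uniq -?cardE ?enum_uniq //.
rewrite nth_cat size_take -cardE jU /bump (leqNgt j k).
have [kj|jk] := ltnP k j; first by rewrite add0n nth_take.
by rewrite nth_drop addSn subnKC // add1n.
Qed.

Lemma sorted_enum U : sorted ltn [seq val i | i <- enum U].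
Proof.
rewrite /enum_mem; apply: (subseq_sorted ltn_trans) (iota_ltn_sorted 0 n).
rewrite -val_enum_ord enumT; exact/map_subseq/filter_subseq.
Qed.

Lemma index_enum U i : i \in U -> index i (enum U) = #|[set k in U | (k < i)%N]|.
Proof.
move=> iU; have := sorted_enum U; have : i \in enum U by rewrite mem_enum.
rewrite cardsE cardE [in RHS](_ : enum _ = [seq k : 'I_n <- enum U | (k < i)%N]).
  move=> iE; rewrite size_filter; have : uniq (enum U) by apply: enum_uniq.
  case/splitPr: iE => s1 s2; rewrite cat_uniq /= => /and3P[_ /norP[is1 _] _].
  rewrite index_cat (negPf is1) /= eqxx addn0 map_cat /= => ss.
  move: ss; rewrite (sorted_pairwise ltn_trans) pairwise_cat /=.
  case/and3P=> /allrelP s12 _ /andP[/allP is2 _].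
  rewrite count_cat /= ltnn add0n -[LHS]addn0; congr (_ + _)%N.
    apply/esym/eqP; rewrite -all_count; apply/allP => k ks1.
    by apply: s12; rewrite ?map_f ?mem_head.
  apply/esym/eqP; rewrite eqn0Ngt -has_count; apply/hasPn => k ks2.
  by rewrite -leqNgt ltnW // is2 // map_f.
rewrite /enum_mem -filter_predI.
by apply: eq_filter => k; rewrite /= ?inE andbC.
Qed.

End EnumOrdinal.

Section Wedge.
Variables (R : realType) (F : scalars R) (X : vectType F).
Implicit Types (s t : seq X) (v : X).
Local Notation n := (\dim {:X}).
Local Notation b := (vbasis {:X}).

Definition coordmx p s : 'M[F]_(p, n) := \matrix_(i, k) coord b k s`_i.

(** The inversions are the pairs of i with a smaller element of U, so their number is the position
    of i in U. The sign in [ext_mul] is thereby the sign of a cofactor along the first row. *)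
Lemma ext_inv1 i (U : {set 'I_n}) :
  i \in U -> ext_inv [set i]%SET (U :\ i)%SET = index i (enum U).
Proof.
move=> iU; rewrite index_enum // /ext_inv.
rewrite -(card_imset (mem [set k in U | (k < i)%N]) (f := fun k => (i, k))); last first.
  by move=> k l [].
apply: eq_card => -[j k]; rewrite !inE /=; apply/idP/imsetP.
  case/andP => /andP[/eqP-> /andP[_ kU]] ki; exists k => //.
  by rewrite inE kU.
case=> l; rewrite inE => /andP[lU li] [-> ->]; rewrite eqxx lU li /= !andbT.
by apply: contraTN li => /eqP->; rewrite ltnn.
Qed.

Lemma ext_mul_vector v (A : ext X) (U : {set 'I_n}) :
  ext_mul (ext_vector v) A U =
  \sum_(i in U) (-1) ^+ index i (enum U) * coord b i v * A (U :\ i)%SET.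
Proof.
rewrite ffunE; under eq_bigr do rewrite ffunE mulr_sumr mulr_suml.
rewrite (exchange_big_dep (mem U)) /=; last first.
  by move=> S i /[!inE] /[swap] /eqP-> ; rewrite finset.sub1set.
apply: eq_bigr => i iU; rewrite (big_pred1 [set i]%SET).
  by rewrite ext_inv1.
by move=> S; rewrite /= inE andbC; case: eqP => //= ->; rewrite finset.sub1set.
Qed.

Lemma wedgeE s (U : {set 'I_n}) : wedge s U =
  if #|U| == size s then \det (sel_cols (size s) (coordmx (size s) s) U) else 0.
Proof.
elim: s U => [|v s IH] U /=.
  by rewrite ffunE cards_eq0; case: eqP => // _; rewrite det_mx00.
rewrite ext_mul_vector; case: eqP => [Us|Us]; last first.
  apply: big1 => i iU; rewrite IH; case: eqP => [Uis|]; rewrite ?mulr0 //.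
  by case: Us; rewrite (cardsD1 i) iU -Uis.
rewrite (expand_det_row _ ord0) big_enum_val.
rewrite (reindex (cast_ord (esym Us))) /=; last first.
  by apply: onW_bij; exists (cast_ord Us); [apply: cast_ordKV | apply: cast_ordK].
apply: eq_bigr => j _.
set x := enum_val _; have xj : x = nth x (enum U) j.
  exact: (enum_val_nth x).
have jU : (j < #|U|)%N by rewrite Us.
have xU : x \in U by apply: enum_valP.
have Ux : #|(U :\ x)%SET| = size s.
  by apply/eqP; rewrite -eqSS -[(size s).+1]Us (cardsD1 x U) xU.
rewrite IH Ux eqxx.
rewrite {1}xj index_uniq ?enum_uniq -?cardE //.
rewrite /cofactor add0n mulrCA mulrA; congr (_ * _ * _).
  by rewrite mxE (nth_map x) -?cardE // -xj mxE.
congr (\det _); apply/matrixP => i k; rewrite !mxE.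
rewrite (nth_map x) -?cardE ?Ux // (nth_map x); last first.
  by rewrite -cardE Us -[(size s).+1]/(size (v :: s)) ltn_ord.
by rewrite !mxE {2}xj nth_enum_setD1.
Qed.

(** A nontrivial relation between the vectors is a row vector killing their coordinate matrix on the
    left, hence killing every maximal minor of it. *)
Lemma wedge_free s : wedge s != 0 -> free s.
Proof.
move=> ws; rewrite -[s]in_tupleE; apply/freeP => k ks i; apply/eqP.
apply: contraNT ws => ki; apply/eqP/ffunP => U; rewrite wedgeE ffunE.
case: eqP => // _; apply/eqP/det0P; exists (\row_j k j).
  by apply: contraNneq ki => /rowP/(_ i); rewrite !mxE => ->.
rewrite -sel_cols_mul (_ : _ *m coordmx (size s) s = 0).
  apply/matrixP => j l; rewrite !mxE.
  by elim: (enum U) (val l) => [|x u IH] [|m] //=; rewrite ?mxE.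
apply/matrixP => j l; rewrite !mxE.
transitivity (coord b l (\sum_i k i *: s`_i)); last by rewrite ks linear0.
by rewrite linear_sum; apply: eq_bigr => m _; rewrite linearZ /= !mxE.
Qed.

End Wedge.

(** * The inner product of the exterior algebra *)

Section ExteriorInnerProduct.
Variables (R : realType) (F : scalars R) (X : vectType F).
Variable g : {dot X for sconj F}.
Implicit Types (s t : seq X) (u v : X) (A B : ext X).
Local Notation n := (\dim {:X}).
Local Notation b := (vbasis {:X}).
Local Notation conj := (sconj F).

Lemma ipC u v : conj (ip g u v) = ip g v u.
Proof. by rewrite /ip (hermC g u v) expr0 mul1r. Qed.

Lemma ipZl a u v : ip g (a *: u) v = conj a * ip g u v.
Proof. by rewrite /ip linearZr_LR. Qed.

Lemma ipZr a u v : ip g u (a *: v) = a * ip g u v.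
Proof. by rewrite /ip linearZl_LR. Qed.

Lemma ip0r u : ip g u 0 = 0. Proof. by rewrite /ip linear0l. Qed.

Lemma ip_suml I (r : seq I) (P : pred I) (f : I -> X) v :
  ip g (\sum_(i <- r | P i) f i) v = \sum_(i <- r | P i) ip g (f i) v.
Proof. by rewrite /ip linear_sumr. Qed.

Lemma ip_sumr I (r : seq I) (P : pred I) (f : I -> X) v :
  ip g v (\sum_(i <- r | P i) f i) = \sum_(i <- r | P i) ip g v (f i).
Proof. by rewrite /ip linear_sumlz. Qed.

Definition ip_mx : 'M[F]_n := \matrix_(k, l) ip g b`_k b`_l.

Lemma ip_coord p q s t :
  \matrix_(i < p, j < q) ip g s`_i t`_j
  = map_mx conj (coordmx p s) *m ip_mx *m (coordmx q t)^T.
Proof.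
apply/matrixP => i j; rewrite !mxE.
rewrite {1}(coord_vbasis (memvf t`_j)) ip_sumr; apply: eq_bigr => l _.
rewrite ipZr !mxE mulrC; congr (_ * _).
rewrite {1}(coord_vbasis (memvf s`_i)) ip_suml; apply: eq_bigr => k _.
by rewrite ipZl !mxE.
Qed.

Lemma gram_detE p s t :
  size s = p -> gram_det g s t = \det (\matrix_(i < p, j < p) ip g s`_i t`_j).
Proof. by move=> <-. Qed.

Lemma size_ext_basis (S : {set 'I_n}) : size (ext_basis S : seq X) = #|S|.
Proof. by rewrite size_map -cardE. Qed.

Lemma gram_det_basis p (S T : {set 'I_n}) : #|S| = p -> #|T| = p ->
  gram_det g (ext_basis S) (ext_basis T)
  = \det (sel_rows p (sel_cols p ip_mx T) S).
Proof.
move=> Sp Tp; rewrite (@gram_detE p) ?size_ext_basis //; congr (\det _).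
apply/matrixP => i j; rewrite !mxE.
have iS : (i < size (enum S))%N by rewrite -cardE Sp.
have jT : (j < size (enum T))%N by rewrite -cardE Tp.
have [x0 _] : exists x0, x0 \in enum S.
  by case: (enum S) iS => // x s _; exists x; rewrite mem_head.
by rewrite !(nth_map x0) // mxE (nth_map x0) // mxE.
Qed.

Lemma map_sel_cols m p (M : 'M[F]_(m, n)) (T : {set 'I_n}) :
  map_mx conj (sel_cols p M T) = sel_cols p (map_mx conj M) T.
Proof.
apply/matrixP => i j; rewrite !mxE.
by elim: (enum T) (val j) => [|x u IH] [|l] //=; rewrite ?mxE ?rmorph0.
Qed.

(** The Gram matrix of s and t factors as a conjugated coordinate matrix, [ip_mx] and a transposed
    coordinate matrix. Cauchy-Binet on the outer product yields the sum over S, on the inner one the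
    sum over T; the minors of [ip_mx] are the Gram determinants of the basis. *)
Lemma ext_ip_wedge s t : ext_ip g (wedge s) (wedge t) =
  if size s == size t then gram_det g s t else 0.
Proof.
set p := size s; rewrite /ext_ip.
transitivity (\sum_(S : {set 'I_n} | #|S| == p) \sum_(T : {set 'I_n} | #|T| == p)
    conj (wedge s S) * wedge t T * gram_det g (ext_basis S) (ext_basis T)).
  rewrite [RHS]big_mkcond; apply: eq_bigr => S _.
  case: eqP => [->//|/eqP/negPf Sp]; apply: big1 => T _.
  by rewrite wedgeE Sp rmorph0 !mul0r.
have [st|st] := eqVneq p (size t); last first.
  apply: big1 => S _; apply: big1 => T /eqP Tp.
  by rewrite [wedge t T]wedgeE Tp (negPf st) mulr0 mul0r.
rewrite (@gram_detE p) // ip_coord -mulmxA Cauchy_Binet; apply: eq_bigr => S /eqP Sp.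
rewrite sel_rows_mul Cauchy_Binet mulr_sumr; apply: eq_bigr => T /eqP Tp.
rewrite (gram_det_basis Sp Tp) !wedgeE Sp Tp -st !eqxx -det_map_mx map_sel_cols.
rewrite [sel_rows p _ T]sel_rowsE trmxK det_tr -!mulrA; congr (_ * _).
by rewrite mulrC sel_rows_cols.
Qed.

End ExteriorInnerProduct.

(** * Scalars and orthonormal bases *)

(* What the proof uses of the two scalar fields; the division into cases R and C
   occurs only where these laws are verified. *)
Record scalars_laws (R : realType) (F : scalars R) : Prop := ScalarsLaws {
  conjM_normE : forall x : F, sconj F x * x = `|x| ^+ 2;
  of_real_rmorph : exists r : {rmorphism R -> F}, of_real F =1 r;
  conj_of_real : forall a, sconj F (of_real F a) = of_real F a;
  re_partD : {morph re_part (s := F) : x y / x + y};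
  re_part_of_realM : forall a x, re_part (of_real F a * x) = a * re_part x;
  re_part1 : re_part (1 : F) = 1;
  ge0_of_real : forall x : F, 0 <= x -> x = of_real F (re_part x);
  of_real_ge0 : forall a, (0 <= of_real F a) = (0 <= a);
  (* [u] is an orthonormal basis of F over R for Re (conj a * b) *)
  real_basis : exists2 u : seq F, uniq u /\ size u = rdim F &
    {in u &, forall a b, re_part (sconj F a * b) = (a == b)%:R} /\
    forall x, x = \sum_(a <- u) of_real F (re_part (sconj F a * x)) * a;
  hermitian_eigenvalue : forall n (M : 'M[F]_n), (0 < n)%N ->
    (forall i j, sconj F (M j i) = M i j) -> exists a, eigenvalue M a }.

Section ScalarsTheory.
Variables (R : realType) (F : scalars R).
Hypothesis F_laws : scalars_laws F.
Local Notation real := (of_real F).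

Lemma of_real0 : real 0 = 0.
Proof. by have [r ->] := of_real_rmorph F_laws; rewrite rmorph0. Qed.

Lemma of_real1 : real 1 = 1.
Proof. by have [r ->] := of_real_rmorph F_laws; rewrite rmorph1. Qed.

Lemma of_realM a b : real (a * b) = real a * real b.
Proof. by have [r E] := of_real_rmorph F_laws; rewrite !E rmorphM. Qed.

Lemma of_real_le a b : (real a <= real b) = (a <= b).
Proof.
have [r E] := of_real_rmorph F_laws.
by rewrite -subr_ge0 !E -rmorphB -E (of_real_ge0 F_laws) subr_ge0.
Qed.

Lemma of_real_sum I (s : seq I) (P : pred I) (f : I -> R) :
  real (\sum_(i <- s | P i) f i) = \sum_(i <- s | P i) real (f i).
Proof.
have [r E] := of_real_rmorph F_laws; rewrite E rmorph_sum.
by apply: eq_bigr => i _; rewrite E.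
Qed.

Lemma of_real_prod I (s : seq I) (P : pred I) (f : I -> R) :
  real (\prod_(i <- s | P i) f i) = \prod_(i <- s | P i) real (f i).
Proof.
have [r E] := of_real_rmorph F_laws; rewrite E rmorph_prod.
by apply: eq_bigr => i _; rewrite E.
Qed.

Lemma of_real_eq0 a : (real a == 0) = (a == 0).
Proof. by have [r E] := of_real_rmorph F_laws; rewrite !E fmorph_eq0. Qed.

Lemma re_part_of_real a : re_part (real a) = a.
Proof.
by rewrite -[real a]mulr1 (re_part_of_realM F_laws) (re_part1 F_laws) mulr1.
Qed.

Lemma re_part0 : re_part (0 : F) = 0.
Proof. by rewrite -of_real0 re_part_of_real. Qed.

Lemma re_part_sum I (s : seq I) (P : pred I) (f : I -> F) :
  re_part (\sum_(i <- s | P i) f i) = \sum_(i <- s | P i) re_part (f i).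
Proof. exact: (big_morph _ (re_partD F_laws) re_part0). Qed.

Lemma re_part_ge0 (x : F) : 0 <= x -> 0 <= re_part x.
Proof. by move=> x0; rewrite -(of_real_ge0 F_laws) -(ge0_of_real F_laws). Qed.

Variables (X : vectType F) (g : {dot X for sconj F}).
Implicit Types (u v w x y : X) (e : seq X) (V W : {vspace X}).

Lemma dotC u v : sconj F (g u v) = g v u.
Proof. by rewrite (hermC g v u) expr0 mul1r. Qed.

Lemma dot_eq0C u v : g u v = 0 -> g v u = 0.
Proof. by rewrite -[g v u]dotC => ->; rewrite rmorph0. Qed.

Lemma dotZl a u v : g (a *: u) v = a * g u v.
Proof. exact: linearZl_LR. Qed.

Lemma dotZr a u v : g u (a *: v) = sconj F a * g u v.
Proof. exact: linearZr_LR. Qed.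

Lemma dotBl u v w : g (u - v) w = g u w - g v w.
Proof. exact: linearBl. Qed.

Lemma dotBr u v w : g u (v - w) = g u v - g u w.
Proof. exact: linearBr. Qed.

Lemma dot0l u : g 0 u = 0. Proof. exact: linear0l. Qed.

Lemma dot0r u : g u 0 = 0. Proof. exact: linear0r. Qed.

Lemma dot_suml I (r : seq I) (P : pred I) (f : I -> X) v :
  g (\sum_(i <- r | P i) f i) v = \sum_(i <- r | P i) g (f i) v.
Proof. exact: linear_sumlz. Qed.

Lemma dot_sumr I (r : seq I) (P : pred I) (f : I -> X) v :
  g v (\sum_(i <- r | P i) f i) = \sum_(i <- r | P i) g v (f i).
Proof. exact: linear_sumr. Qed.

Lemma dot_gt0 u : u != 0 -> 0 < g u u.
Proof. exact: neq0_dnorm_gt0. Qed.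

Lemma dot_ge0 u : 0 <= g u u.
Proof. by have [->|/dot_gt0/ltW //] := eqVneq u 0; rewrite dot0l. Qed.

Lemma dot_eq0 u : (g u u == 0) = (u == 0).
Proof.
have [->|u0] := eqVneq u 0; first by rewrite dot0l eqxx.
by rewrite gt_eqF // dot_gt0.
Qed.

Lemma dotZ a b u v : g (a *: u) (b *: v) = a * (sconj F b * g u v).
Proof. by rewrite dotZl dotZr. Qed.

Lemma normalize u : u != 0 -> exists2 c, c != 0 & g (c *: u) (c *: u) = 1.
Proof.
move=> u0; pose r := re_part (g u u).
have uE : g u u = real r by apply: ge0_of_real => //; apply: dot_ge0.
have r0 : 0 < r.
  rewrite lt_neqAle re_part_ge0 ?dot_ge0 // andbT eq_sym.
  by rewrite -of_real_eq0 -uE dot_eq0.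
exists (real (Num.sqrt r)^-1); first by rewrite of_real_eq0 invr_eq0 gt_eqF ?sqrtr_gt0.
rewrite dotZ (conj_of_real F_laws) uE -!of_realM -{3}[r]sqr_sqrtr ?ltW //.
by rewrite expr2 mulKf ?mulVf ?of_real1 // gt_eqF // sqrtr_gt0.
Qed.

Lemma orthonormal_cons v e : orthonormal g (v :: e) =
  [&& g v v == 1, all (fun w => g v w == 0) e & orthonormal g e].
Proof. by rewrite /orthonormal /= andbT -!andbA; congr (_ && _); rewrite andbCA. Qed.

Lemma orthonormal_seqP e :
  reflect (uniq e /\ {in e &, forall u v, g u v = (u == v)%:R}) (orthonormal g e).
Proof.
apply: (iffP idP).
  elim: e => // v e IH; rewrite orthonormal_cons.
  case/and3P=> /eqP gv /allP ve /IH[ue ge].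
  have nve : v \notin e.
    by apply/negP => /ve; rewrite gv oner_eq0.
  split; first by rewrite /= nve.
  move=> x y; rewrite !inE => /predU1P[->|xe] /predU1P[->|ye].
  - by rewrite eqxx.
  - by rewrite (eqP (ve _ ye)); case: eqP ye nve => // <- ->.
  - by rewrite (dot_eq0C (eqP (ve _ xe))); case: eqP xe nve => // -> ->.
  - exact: ge.
elim: e => // v e IH [/= /andP[ve ue] ge]; rewrite orthonormal_cons.
have -> : orthonormal g e.
  by apply: IH; split=> // x y xe ye; apply: ge; rewrite inE ?xe ?ye orbT.
rewrite ge ?mem_head // !eqxx andbT /=; apply/allP => w we; rewrite ge ?inE ?eqxx ?we ?orbT //.
by case: (v =P w) ve => [->|_]; rewrite ?we //= eqxx.
Qed.

Lemma orthonormal_nth e i j : orthonormal g e -> (i < size e)%N -> (j < size e)%N ->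
  g e`_i e`_j = (i == j)%:R.
Proof.
by case/orthonormal_seqP => ue ge ie je; rewrite ge ?mem_nth // nth_uniq.
Qed.

Lemma orthonormal_freeE e : orthonormal g e -> free e.
Proof.
move=> oe; rewrite -[e]in_tupleE; apply/freeP => k /= ke i.
have := congr1 (fun x => g x e`_i) ke; rewrite dot0l dot_suml.
rewrite (bigD1 i) //= big1 ?addr0 => [|j ji]; last first.
  by rewrite dotZl orthonormal_nth // val_eqE (negPf ji) mulr0.
by rewrite dotZl orthonormal_nth // eqxx mulr1.
Qed.

Lemma orthonormal_expand e x : orthonormal g e -> x \in <<e>>%VS ->
  x = \sum_(v <- e) g x v *: v.
Proof.
move=> oe xe; rewrite (big_nth 0) big_mkord.
rewrite {1}(coord_span (X := in_tuple e) xe); apply: eq_bigr => i _ /=.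
congr (_ *: _); rewrite {2}(coord_span (X := in_tuple e) xe) dot_suml.
rewrite (bigD1 i) //= big1 ?addr0 => [|j ji]; last first.
  by rewrite dotZl orthonormal_nth // val_eqE (negPf ji) mulr0.
by rewrite dotZl orthonormal_nth // eqxx mulr1.
Qed.

(** Induction on the dimension: the vector u given for V is followed by a basis of its orthogonal
    complement in V. The relation Q is trivial for plain orthonormal bases, and the orthogonality of
    images for diagonalization. *)
Lemma orthonormal_basis_ind (Q : X -> X -> Prop) :
  (forall u v, Q u v -> Q v u) ->
  (forall V, V != 0%VS -> exists u, [/\ u \in V, g u u = 1 &
     {in V, forall v, g u v = 0 -> Q u v}]) ->
  forall V, exists e, [/\ basis_of V e, orthonormal g e &
     {in e &, forall u v, u != v -> Q u v}].
Proof.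
move=> Qsym HQ V; move dV : (\dim V) => d; elim: d V dV => [|d IH] V dV.
  exists [::]; split=> //; rewrite /basis_of nil_free andbT span_nil eq_sym.
  by rewrite -dimv_eq0 dV.
have V0 : V != 0%VS by rewrite -dimv_eq0 dV.
have [u [uV gu Qu]] := HQ V V0.
have uo : u \notin orthov g V.
  by apply/mem_orthovPn; exists u => //; rewrite /= gu oner_eq0.
have [|e [be oe Qe]] := IH (V :&: orthov g <[u]>)%VS.
  by rewrite -eq_dim_orthov1 // dV.
have eV v : v \in e -> v \in V /\ g u v = 0.
  move/(basis_mem be); rewrite memv_cap mem_orthov1 => /andP[-> /eqP vu].
  by split=> //; apply: dot_eq0C.
have oue : orthonormal g (u :: e).
  rewrite orthonormal_cons gu eqxx oe andbT /=; apply/allP => v /eV[_ ->].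
  exact: eqxx.
exists (u :: e); split=> //; last first.
  move=> x y; rewrite !inE => /predU1P[->|xe] /predU1P[->|ye].
  - by rewrite eqxx.
  - by move=> _; have [yV yu] := eV _ ye; apply: Qu.
  - by move=> _; have [xV xu] := eV _ xe; apply/Qsym/Qu.
  - exact: Qe.
rewrite basisEfree orthonormal_freeE //=; apply/andP; split.
  apply/span_subvP => v; rewrite inE => /predU1P[->//|/eV[]//].
by rewrite dV ltnS -(size_basis (X := in_tuple e) be) -eq_dim_orthov1 // dV.
Qed.

Lemma exists_unit V : V != 0%VS -> exists2 u, u \in V & g u u = 1.
Proof.
rewrite -vpick0 => u0; have [c _ gc] := normalize u0.
by exists (c *: vpick V) => //; rewrite memvZ // memv_pick.
Qed.

Lemma exists_orthonormal_basis V : exists2 e, basis_of V e & orthonormal g e.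
Proof.
have [|W W0|e [be oe _]] := @orthonormal_basis_ind (fun _ _ => True) _ _ V => //.
  by have [u uW gu] := exists_unit W0; exists u.
by exists e.
Qed.

(** An eigenvector of the Hermitian matrix of the form [g (L u) (L v)] on V gives a vector u0 with
    [g (L u0) (L v) = a * g u0 v] for all v in V, so that orthogonality to u0 passes to the images
    under L. *)
Lemma orthonormal_basis_diag (L : 'End(X)) V :
  exists e, [/\ basis_of V e, orthonormal g e &
    {in e &, forall u v, u != v -> g (L u) (L v) = 0}].
Proof.
apply: orthonormal_basis_ind => [u v|{}V V0]; first exact: dot_eq0C.
have [e be oe] := exists_orthonormal_basis V.
have e0 : (0 < size e)%N.
  rewrite lt0n; apply: contraNneq V0 => /size0nil e0.
  by rewrite -(span_basis be) e0 span_nil.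
pose M : 'M[F]_(size e) := \matrix_(i, j) g (L e`_i) (L e`_j).
have [|a /eigenvalueP[k kM k0]] := hermitian_eigenvalue F_laws (M := M) e0.
  by move=> i j; rewrite !mxE dotC.
(* The row eigenvector k supplies the coordinates of u0, in agreement with the linearity of g in its
   first argument. *)
pose u0 := \sum_i k 0 i *: e`_i.
have u0e j : g u0 (e`_(j : 'I_(size e))) = k 0 j.
  rewrite dot_suml (bigD1 j) //= big1 ?addr0 => [|i ij]; last first.
    by rewrite dotZl orthonormal_nth // val_eqE (negPf ij) mulr0.
  by rewrite dotZl orthonormal_nth // eqxx mulr1.
have u0N0 : u0 != 0.
  apply: contraNneq k0 => u0E; apply/eqP/rowP => j.
  by rewrite -u0e u0E dot0l mxE.
have [c c0 gc] := normalize u0N0.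
exists (c *: u0); split => //.
  rewrite memvZ // memv_suml // => i _; rewrite memvZ // (basis_mem be) //.
  exact: mem_nth.
move=> v vV; rewrite linearZ !dotZl /= => /eqP; rewrite mulf_eq0 (negPf c0) /=.
move=> /eqP uv; suff -> : g (L u0) (L v) = a * g u0 v by rewrite uv !mulr0.
have -> : v = \sum_j g v e`_(j : 'I_(size e)) *: e`_j.
  by rewrite {1}(orthonormal_expand oe (x := v)) ?(span_basis be) // (big_nth 0) big_mkord.
rewrite [X in g _ X]linear_sum !dot_sumr mulr_sumr; apply: eq_bigr => j _ /=.
rewrite linearZ !dotZr /= mulrCA; congr (_ * _); rewrite u0e.
have /rowP/(_ j) := kM; rewrite !mxE => <-.
rewrite linear_sum dot_suml; apply: eq_bigr => i _ /=.
by rewrite linearZ dotZl mxE.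
Qed.

End ScalarsTheory.

(** * Orthogonal projections and principal bases *)

Lemma acos_unit_itv (R : realType) (c : R) :
  0 <= c <= 1 -> cos (acos c) = c /\ 0 <= acos c <= pi / 2.
Proof.
case/andP=> c0 c1; have cI : -1 <= c <= 1.
  by rewrite c1 andbT (le_trans _ c0) // oppr_le0.
have cK : cos (acos c) = c by rewrite acosK // in_itv.
split=> //; rewrite acos_ge0 //= leNgt; apply/negP => pc.
have pi0 := pi_ge0 R.
have : cos (acos c) < cos (pi / 2).
  rewrite ltr_cos // in_itv /= ?acos_ge0 ?acos_lepi ?divr_ge0 //=.
  by rewrite ler_piMr // invf_le1 // ler1n.
by rewrite cK cos_pihalf ltNge c0.
Qed.

Lemma cos_eq0_pihalf (R : realType) (th : R) : 0 <= th <= pi / 2 -> cos th = 0 -> th = pi / 2.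
Proof.
move=> /andP[th0 th1]; rewrite -[in X in X -> _](cos_pihalf R).
have p0 := pi_ge0 R; have p1 : pi / 2 <= pi :> R.
  by rewrite ler_piMr // invf_le1 // ler1n.
by apply: cos_inj; rewrite in_itv /= ?th0 ?(le_trans th1) // divr_ge0.
Qed.

Section PrincipalBases.
Variables (R : realType) (F : scalars R).
Hypothesis F_laws : scalars_laws F.
Variables (X : vectType F) (g : {dot X for sconj F}).
Local Notation real := (of_real F).
Implicit Types (u v w x y : X) (e f : seq X) (V W : {vspace X}).
Local Notation P := (orth_proj g).

Lemma capv_orthov W : (W :&: orthov g W = 0)%VS.
Proof.
apply/eqP; rewrite -subv0; apply/subvP => x; rewrite memv_cap => /andP[xW].
move=> /mem_orthovP/(_ x xW) /eqP xx; rewrite memv0.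
by rewrite -(dot_eq0 g).
Qed.

Lemma orth_proj_mem W x : P W x \in W.
Proof. exact: memv_pi. Qed.

Lemma orth_projD W x y : P W (x + y) = P W x + P W y.
Proof. exact: linearD. Qed.

Lemma orth_projZ W a x : P W (a *: x) = a *: P W x.
Proof. exact: linearZ. Qed.

Lemma orth_projK W x : x \in W -> P W x = x.
Proof. exact/daddv_pi_id/capv_orthov. Qed.

Lemma orth_proj_orthov W x : x \in orthov g W -> P W x = 0.
Proof.
move=> xo; have C := capv_orthov W.
have /(congr1 (fun y => y - x)) := daddv_pi_add C (subvP (addvSr W (orthov g W)) _ xo).
by rewrite [X in _ + X - _]daddv_pi_id 1?capvC // addrK subrr.
Qed.

Lemma orthov_memP W x : reflect {in W, forall w, g x w = 0} (x \in orthov g W).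
Proof. exact: mem_orthovP. Qed.

(** This splits every x into a part in W and a part orthogonal to W. As these spaces meet in 0, the
    projection [orth_proj] is the expansion along e. *)
Lemma sub_expand_orthov W e x : basis_of W e -> orthonormal g e ->
  x - \sum_(v <- e) g x v *: v \in orthov g W.
Proof.
move=> be /[dup] oe' /orthonormal_seqP[ue oe].
apply/orthov_memP => w; rewrite -(span_basis be) => we.
rewrite [w](orthonormal_expand oe' we) dot_sumr big_seq big1 // => v ve.
rewrite dotZr dotBl dot_suml (bigD1_seq v) //=.
rewrite big1_seq ?addr0 => [|u /andP[uv ue']]; last first.
  by rewrite dotZl (oe u v) // (negPf uv) mulr0.
by rewrite dotZl (oe v v) // eqxx mulr1 subrr mulr0.
Qed.

Lemma orth_projE W e x : basis_of W e -> orthonormal g e ->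
  P W x = \sum_(v <- e) g x v *: v.
Proof.
move=> be oe; rewrite -[x in LHS](subrK (\sum_(v <- e) g x v *: v)).
rewrite orth_projD orth_proj_orthov ?sub_expand_orthov // add0r.
rewrite orth_projK // big_seq memv_suml // => v ve.
by rewrite memvZ // (basis_mem be).
Qed.

Lemma sub_orth_proj W x : x - P W x \in orthov g W.
Proof.
have [e be oe] := exists_orthonormal_basis F_laws g W.
by rewrite (orth_projE x be oe) sub_expand_orthov.
Qed.

Lemma dot_projl W x w : w \in W -> g (P W x) w = g x w.
Proof.
move=> wW; apply/eqP; rewrite eq_sym -subr_eq0 -dotBl.
by have /orthov_memP -> := sub_orth_proj W x.
Qed.

Lemma dot_projr W x w : w \in W -> g w (P W x) = g w x.
Proof. by move=> wW; rewrite -dotC dot_projl // dotC. Qed.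

Lemma dot_proj_le W x : g (P W x) (P W x) <= g x x.
Proof.
rewrite -subr_ge0 dot_projl ?orth_proj_mem //.
have -> : g x x - g x (P W x) = g (x - P W x) (x - P W x).
  by rewrite dotBl !dotBr -(dot_projr x (orth_proj_mem _ _)) subrr subr0.
exact: dot_ge0.
Qed.

(** On the vectors of a principal basis of V these are the cosines of the principal angles, and 0
    for indices from [\dim W] on. *)
Definition proj_norm W v := Num.sqrt (re_part (g (P W v) (P W v))).

Lemma proj_normE W v :
  g (P W v) (P W v) = real (proj_norm W v ^+ 2).
Proof.
rewrite sqr_sqrtr; first by apply: (ge0_of_real F_laws); apply: dot_ge0.
by apply: (re_part_ge0 F_laws); apply: dot_ge0.
Qed.

Lemma proj_norm_unit W v : g v v = 1 -> 0 <= proj_norm W v <= 1.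
Proof.
move=> gv; rewrite sqrtr_ge0 /= -(expr_le1 (n := 2)) ?sqrtr_ge0 //.
rewrite -(of_real_le F_laws) -proj_normE (of_real1 F_laws) -gv.
exact: dot_proj_le.
Qed.

Lemma exists_principal_bases V W : exists e f, principal_bases g V W e f.
Proof.
have [e0 [be0 oe0 d0]] := orthonormal_basis_diag F_laws g (daddv_pi W (orthov g W)) V.
have [ue0 ge0] := orthonormal_seqP _ _ oe0.
pose c v := proj_norm W v; pose A v := acos (c v).
have c1 v : v \in e0 -> 0 <= c v <= 1.
  by move=> ve; rewrite proj_norm_unit // ge0 // eqxx.
(* Vectors with nonzero projection come first, by increasing angle; those of [e2] project to 0 and
   come last, with angle pi / 2. *)
pose e1 := sort (relpre A <=%R) [seq v <- e0 | c v != 0].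
pose e2 := [seq v <- e0 | c v == 0].
have pe : perm_eq (e1 ++ e2) e0.
  rewrite perm_sym -(perm_filterC (fun v => c v != 0)) perm_sym.
  apply: perm_cat; first by rewrite perm_sort.
  by rewrite (eq_filter (a2 := fun v => c v == 0)) // => v /=; rewrite negbK.
have be : basis_of V (e1 ++ e2) by rewrite (perm_basis _ pe).
have oe : orthonormal g (e1 ++ e2).
  apply/orthonormal_seqP; split; first by rewrite (perm_uniq pe).
  by move=> u v; rewrite !(perm_mem pe); apply: ge0.
have sz_e : size (e1 ++ e2) = \dim V by rewrite (size_basis (X := in_tuple _) be).
have me1 v : v \in e1 -> v \in e0 /\ real (c v) != 0.
  by rewrite mem_sort mem_filter of_real_eq0 // => /andP[-> ->].
(* The normalized projections are orthonormal because the projections of distinct vectors of [e0]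
   are orthogonal. *)
pose k v := (real (c v))^-1 *: P W v.
have kk : {in e1 &, forall u v, g (k u) (k v) = (u == v)%:R}.
  move=> u v /me1[ue cu] /me1[ve cv]; rewrite /k dotZ fmorphV (conj_of_real F_laws).
  have [->|uv] := eqVneq u v; last by rewrite [g _ _]d0 // !mulr0.
  by rewrite proj_normE expr2 of_realM // mulKf ?mulVf.
have kI : {in e1 &, injective k}.
  move=> u v ue ve kuv; apply/eqP; have := kk u v ue ve.
  by rewrite kuv kk // eqxx; case: eqP => // _ /eqP; rewrite oner_eq0.
have ue1 : uniq e1 by rewrite sort_uniq filter_uniq.
pose f1 := map k e1.
have of1 : orthonormal g f1.
  apply/orthonormal_seqP; split; first by rewrite map_inj_in_uniq.
  move=> _ _ /mapP[u ue ->] /mapP[v ve ->]; rewrite kk //.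
  by rewrite (inj_in_eq kI).
have f1W v : v \in f1 -> v \in W.
  by case/mapP=> u _ ->; rewrite memvZ // orth_proj_mem.
have [f2 bf2 of2] := exists_orthonormal_basis F_laws g (W :&: orthov g <<f1>>)%VS.
have mf2 v : v \in f2 -> v \in W /\ {in f1, forall u, g v u = 0}.
  move/(basis_mem bf2); rewrite memv_cap => /andP[-> /orthov_memP vf].
  by split=> // u uf; rewrite vf // memv_span.
have onf : orthonormal g (f1 ++ f2).
  have [uf1 gf1] := orthonormal_seqP _ _ of1; have [uf2 gf2] := orthonormal_seqP _ _ of2.
  have dis u v : u \in f1 -> v \in f2 -> (u == v) = false.
    move=> uf /mf2[_ vf]; apply/eqP => uv; have := gf1 u u uf uf.
    by rewrite {1}uv vf // eqxx => /esym/eqP; rewrite oner_eq0.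
  apply/orthonormal_seqP; split.
    rewrite cat_uniq uf1 uf2 andbT /=; apply/hasPn => v vf2; apply/negP => vf1.
    by have := dis v v vf1 vf2; rewrite eqxx.
  move=> u v; rewrite !mem_cat => /orP[uf|uf] /orP[vf|vf]; first exact: gf1.
  - by rewrite dis //; apply: dot_eq0C; apply: (mf2 _ vf).2.
  - by rewrite eq_sym dis //; apply: (mf2 _ uf).2.
  - exact: gf2.
have bf : basis_of W (f1 ++ f2).
  rewrite /basis_of (orthonormal_freeE onf) andbT eqEsubv; apply/andP; split.
    apply/span_subvP => v; rewrite mem_cat => /orP[/f1W//|/mf2[]//].
  apply/subvP => w wW; rewrite -[w](subrK (P <<f1>>%VS w)) span_cat addrC.
  apply: memv_add; first exact: orth_proj_mem.
  rewrite (span_basis bf2) memv_cap sub_orth_proj andbT rpredB //.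
  have /subvP : (<<f1>> <= W)%VS by apply/span_subvP.
  by apply; apply: orth_proj_mem.
have sz_f : size (f1 ++ f2) = \dim W by rewrite (size_basis (X := in_tuple _) bf).
pose m := minn (\dim V) (\dim W).
have e1m : (size e1 <= m)%N.
  by rewrite leq_min -sz_e -sz_f !size_cat size_map !leq_addr.
(* Right angles fill the list up to length m; they bound all the others, so the list stays
   sorted. *)
pose theta := map A e1 ++ nseq (m - size e1) (pi / 2).
have A_bound v : v \in e1 -> cos (A v) = c v /\ 0 <= A v <= pi / 2.
  by move=> /me1[ve _]; apply: acos_unit_itv; apply: c1.
exists (e1 ++ e2), (f1 ++ f2), theta; split; [split|split].
- by rewrite size_cat size_nseq size_map subnKC.
- rewrite (sorted_pairwise le_trans) pairwise_cat; apply/and3P; split.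
  + apply/allrelP => _ y /mapP[v ve ->]; rewrite mem_nseq => /andP[_ /eqP->].
    by case: (A_bound v ve) => _ /andP[].
  + rewrite -(sorted_pairwise le_trans) sorted_map.
    by apply: sort_sorted => u v; apply: le_total.
  + apply/(pairwiseP 0) => i j; rewrite !inE size_nseq => im jm _.
    by rewrite !nth_nseq im jm.
- move=> t; rewrite mem_cat => /orP[/mapP[v /A_bound[_ ?] ->]//|].
  by rewrite mem_nseq => /andP[_ /eqP->]; rewrite lexx divr_ge0 // pi_ge0.
- by [].
- by [].
- move=> i j iV jW.
  have fjW : (f1 ++ f2)`_j \in W.
    by rewrite (basis_mem bf) // mem_nth // sz_f.
  rewrite /ip -(dot_projr _ fjW).
  have [ie|ei] := ltnP i (size e1).
    have ve : e1`_i \in e1 by rewrite mem_nth.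
    have -> : P W (e1 ++ e2)`_i = real (c e1`_i) *: (f1 ++ f2)`_i.
      rewrite !nth_cat size_map ie (nth_map 0) // /k scalerA mulfV ?scale1r //.
      exact: (me1 _ ve).2.
    rewrite dotZr (conj_of_real F_laws) (orthonormal_nth onf) ?sz_f //; last first.
      by rewrite -sz_f size_cat size_map ltn_addr.
    rewrite nth_cat size_map ie (nth_map 0) // (A_bound _ ve).1 eq_sym.
    by case: eqP; rewrite ?mulr1 ?mulr0.
  have -> : P W (e1 ++ e2)`_i = 0.
    apply/eqP; rewrite -(dot_eq0 g) proj_normE nth_cat ltnNge ei /=.
    have : e2`_(i - size e1) \in e2.
      by rewrite mem_nth // -(ltn_add2r (size e1)) subnK // addnC -size_cat sz_e.
    by rewrite mem_filter => /andP[/eqP + _]; rewrite /c => ->; rewrite expr0n of_real0.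
  (* The projection is 0, which also fits the diagonal entry: past [size e1] the angle in [theta] is
     pi / 2. *)
  rewrite dot0r; case: eqP => // ij.
  rewrite nth_cat size_map ltnNge ei /= nth_nseq ltn_sub2r.
    by rewrite cos_pihalf of_real0.
  - by rewrite (leq_ltn_trans ei) // leq_min iV ij jW.
  - by rewrite leq_min iV ij jW.
Qed.

End PrincipalBases.

(** * Volumes of projected parallelotopes *)

Section VolumeRatio.
Variables (R : realType) (F : scalars R).
Hypothesis F_laws : scalars_laws F.
Variables (X : vectType F) (g : {dot X for sconj F}).
Local Notation real := (of_real F).
Implicit Types (v w x y : X) (e S : seq X) (V W : {vspace X}).

Lemma volE k S : size S = k ->
  vol g S = Num.sqrt (\det (\matrix_(i < k, j < k) re_part (ip g S`_i S`_j))).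
Proof. by move=> <-. Qed.

Lemma rfreeP k S : size S = k -> rfree S ->
  forall c : 'I_k -> R, \sum_(i < k) real (c i) *: S`_i = 0 -> forall i, c i = 0.
Proof. by move=> <-. Qed.

Lemma re_ip_sum k l (a : 'I_k -> R) (b : 'I_l -> R) (x : 'I_k -> X) (y : 'I_l -> X) :
  re_part (ip g (\sum_i real (a i) *: x i) (\sum_j real (b j) *: y j))
  = \sum_i \sum_j a i * b j * re_part (ip g (x i) (y j)).
Proof.
rewrite ip_suml (re_part_sum F_laws); apply: eq_bigr => i _.
rewrite ip_sumr (re_part_sum F_laws); apply: eq_bigr => j _.
rewrite ipZl ipZr (conj_of_real F_laws) mulrA -(of_realM F_laws).
by rewrite (re_part_of_realM F_laws).
Qed.

Section RealBasis.
Variables (V : {vspace X}) (e : seq X) (u : seq F).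
Hypotheses (be : basis_of V e) (oe : orthonormal g e).
Hypotheses (uu : uniq u) (su : size u = rdim F).
Hypothesis ou : {in u &, forall a b, re_part (sconj F a * b) = (a == b)%:R}.
Hypothesis u_expand :
  forall x : F, x = \sum_(a <- u) real (re_part (sconj F a * x)) * a.

(** An orthonormal basis of V over the reals for the real part of the inner product, made from a
    basis e of V over F and a basis u of F over the reals. *)
Definition real_span_basis := [seq a *: v | v <- e, a <- u].
Local Notation E := real_span_basis.

Lemma mem_real_basis x : x \in E -> exists v a, [/\ v \in e, a \in u & x = a *: v].
Proof. by case/allpairsP => -[v a] /= [ve au ->]; exists v, a. Qed.

Lemma re_ip_scale a b v w : a \in u -> b \in u -> v \in e -> w \in e ->
  re_part (ip g (a *: v) (b *: w)) = ((v == w) && (a == b))%:R.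
Proof.
move=> au bu ve we; have [_ ge] := orthonormal_seqP _ _ oe.
rewrite ipZl ipZr mulrA [ip g v w]ge // eq_sym.
by case: eqP; rewrite ?mulr1 ?mulr0 ?ou // (re_part0 F_laws).
Qed.

Lemma real_scale_inj a b v w : a \in u -> b \in u -> v \in e -> w \in e ->
  a *: v = b *: w -> v = w /\ a = b.
Proof.
move=> au bu ve we ab; have := re_ip_scale au bu ve we.
rewrite -ab re_ip_scale // !eqxx /=.
by case: eqP; case: eqP => //= _ _ /eqP; rewrite oner_eq0.
Qed.

Lemma real_basis_uniq : uniq E.
Proof.
have [ue _] := orthonormal_seqP _ _ oe.
apply: allpairs_uniq => // -[v a] [w b].
move=> /allpairsP[[v' a'] /= [ve au [-> ->]]] /allpairsP[[w' b'] /= [we bu [-> ->]]].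
by case/real_scale_inj => // -> ->.
Qed.

Lemma size_real_basis : size E = (rdim F * \dim V)%N.
Proof.
by rewrite size_allpairs su mulnC (size_basis (X := in_tuple e) be).
Qed.

Lemma re_ip_real_basis : {in E &, forall x y, re_part (ip g x y) = (x == y)%:R}.
Proof.
move=> _ _ /mem_real_basis[v [a [ve au ->]]] /mem_real_basis[w [b [we bu ->]]].
rewrite re_ip_scale //; case: (_ *: _ =P _) => [/real_scale_inj[]// -> ->|].
  by rewrite !eqxx.
by case: eqP => //= -> ; case: eqP => // ->.
Qed.

Lemma real_basis_expand x : x \in V ->
  x = \sum_(y <- E) real (re_part (ip g y x)) *: y.
Proof.
move=> xV; rewrite big_allpairs_dep {1}(orthonormal_expand oe (x := x)) ?(span_basis be) //.
apply: eq_bigr => v _; rewrite {1}(u_expand (g x v)) scaler_suml.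
by apply: eq_bigr => a _; rewrite scalerA ipZl.
Qed.

Lemma real_basis_rfree : rfree E.
Proof.
move=> c c0 j; have := congr1 (fun x => re_part (ip g E`_j x)) c0.
rewrite ip0r (re_part0 F_laws) ip_sumr (re_part_sum F_laws) (bigD1 j) //=.
rewrite big1 => [|i ij]; rewrite ipZr (re_part_of_realM F_laws) re_ip_real_basis ?mem_nth //.
  by rewrite eqxx mulr1 addr0.
by rewrite nth_uniq ?real_basis_uniq // val_eqE eq_sym (negPf ij) mulr0.
Qed.

Lemma real_basis_sub : {subset E <= V}.
Proof.
by move=> _ /mem_real_basis[v [a [ve _ ->]]]; rewrite memvZ // (basis_mem be).
Qed.

Variable S : (rdim F * \dim V).-tuple X.
Hypothesis SV : {subset S <= V}.

Definition real_coords : 'M[R]_(rdim F * \dim V) :=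
  \matrix_(i, j) re_part (ip g E`_j S`_i).

Lemma real_coordsE (i : 'I_(rdim F * \dim V)) :
  S`_i = \sum_j real (real_coords i j) *: E`_j.
Proof.
rewrite {1}(real_basis_expand (x := S`_i)) ?SV ?mem_nth ?size_tuple //.
rewrite (big_nth 0) size_real_basis big_mkord.
by apply: eq_bigr => j _; rewrite mxE.
Qed.

(** The Gram matrix of the images is M D M^T, with M the coordinates of the edges and D the squared
    lengths of the images of E. Taking L to be the projection, then the identity, gives numerator
    and denominator of the volume ratio with the same factor in M. *)
Lemma vol_linear (L : 'End(X)) :
  {in E &, forall x y, x != y -> re_part (ip g (L x) (L y)) = 0} ->
  vol g [seq L x | x <- S]
  = `|\det real_coords| * Num.sqrt (\prod_(y <- E) re_part (ip g (L y) (L y))).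
Proof.
move=> LE; rewrite (volE (k := (rdim F * \dim V)%N)) ?size_map ?size_tuple //.
pose d : 'rV[R]_(rdim F * \dim V) := \row_j re_part (ip g (L E`_j) (L E`_j)).
have -> : \matrix_(i, j) re_part (ip g [seq L x | x <- S]`_i [seq L x | x <- S]`_j)
          = real_coords *m diag_mx d *m real_coords^T.
  apply/matrixP => i j; rewrite mxE !(nth_map 0) ?size_tuple // !real_coordsE !linear_sum.
  under eq_bigr do rewrite linearZ.
  under [X in ip _ _ X]eq_bigr do rewrite linearZ.
  rewrite re_ip_sum mxE exchange_big; apply: eq_bigr => l _ /=.
  rewrite mul_mx_diag !mxE (bigD1 l) //= big1 ?addr0 => [|m ml].
    by rewrite mulrAC !mxE.
  rewrite LE ?mulr0 ?mem_nth ?size_real_basis //.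
  by rewrite nth_uniq ?real_basis_uniq ?size_real_basis.
rewrite !det_mulmx det_tr det_diag mulrAC -expr2 sqrtrM ?sqr_ge0 // sqrtr_sqr.
congr (_ * Num.sqrt _); rewrite (big_nth 0) size_real_basis big_mkord.
by apply: eq_bigr => j _; rewrite mxE.
Qed.

(** A row vector killed by the coordinate matrix would be a nontrivial real relation between the
    edges. *)
Lemma det_real_coords : rfree S -> \det real_coords != 0.
Proof.
move=> fS; apply/negP => /det0P[k k0 kM].
case/negP: k0; apply/eqP/rowP => i; rewrite mxE.
apply: (rfreeP (size_tuple S) fS (c := fun i => k 0 i)) => {i}.
under eq_bigr do rewrite real_coordsE scaler_sumr.
rewrite exchange_big big1 // => j _ /=.
under eq_bigr do rewrite scalerA -(of_realM F_laws).
rewrite -scaler_suml -(of_real_sum F_laws).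
by have /rowP/(_ j) := kM; rewrite !mxE => ->; rewrite (of_real0 F_laws) scale0r.
Qed.

End RealBasis.

Lemma vol_proj_ratio V W e (S : (rdim F * \dim V).-tuple X) :
  basis_of V e -> orthonormal g e ->
  {in e &, forall v w, v != w -> g (orth_proj g W v) (orth_proj g W w) = 0} ->
  {subset S <= V} -> rfree S ->
  vol g [seq orth_proj g W x | x <- S] / vol g S
  = (\prod_(v <- e) proj_norm g W v) ^+ rdim F.
Proof.
move=> be oe de SV fS.
have [u [uu su] [ou ue]] := real_basis F_laws.
have [_ ge] := orthonormal_seqP _ _ oe.
rewrite (vol_linear be oe uu su ou ue SV); last first.
  move=> _ _ /mem_real_basis[v [a [ve au ->]]] /mem_real_basis[w [b [we bu ->]]].
  move=> xy; rewrite !linearZ /= ipZl ipZr.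
  (* For distinct v and w the projections are orthogonal by hypothesis; for v = w orthogonality over
     the reals comes from that of a and b in the basis u of F. *)
  have [vw|vw] := eqVneq v w; last first.
    by rewrite [ip g _ _]de ?mulr0 ?(re_part0 F_laws) // eq_sym.
  rewrite -vw [ip g _ _](proj_normE F_laws) mulrA mulrC (re_part_of_realM F_laws) ou //.
  by case: (a =P b) xy => [->|_ _]; rewrite ?vw ?eqxx ?mulr0.
have -> : vol g S = `|\det (real_coords e u S)|.
  rewrite -[tval S in LHS]map_id (eq_map (g := \1%VF)); last by move=> x; rewrite id_lfunE.
  rewrite (vol_linear be oe uu su ou ue SV) => [|x y xE yE xy].
    rewrite big_seq big1 ?sqrtr1 ?mulr1 // => y yE.
    by rewrite !id_lfunE (re_ip_real_basis oe ou) // eqxx.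
  by rewrite !id_lfunE (re_ip_real_basis oe ou) // (negPf xy).
rewrite mulrAC mulfV ?mul1r; last by rewrite normr_eq0 (det_real_coords be oe su ue SV).
(* Each v contributes [rdim F] vectors [a *: v], all with projections of the same length as that of
   v; this is the source of the exponent. *)
have -> : \prod_(y <- real_span_basis e u)
    re_part (ip g (orth_proj g W y) (orth_proj g W y))
  = ((\prod_(v <- e) proj_norm g W v) ^+ rdim F) ^+ 2.
  rewrite big_allpairs_dep -prodrXl -prodrXl big_seq [RHS]big_seq.
  apply: eq_bigr => v ve; rewrite (eq_big_seq (fun=> proj_norm g W v ^+ 2)) => [|a au].
    by rewrite (big_nth 0) prodr_const_nat subn0 su -!exprM mulnC.
  rewrite !orth_projZ ipZl ipZr [ip g _ _](proj_normE F_laws) mulrA mulrC.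
  by rewrite (re_part_of_realM F_laws) ou // eqxx mulr1.
rewrite sqrtr_sqr ger0_norm // exprn_ge0 //.
by apply: prodr_ge0 => v _; apply: sqrtr_ge0.
Qed.

(** The arccosine of the product satisfies the defining property for every parallelotope, so [xget]
    does not return its default. Conversely the chosen angle has this cosine, as a single
    parallelotope shows: both numbers are nonnegative and have equal powers. *)
Lemma cos_asym_angle V W e :
  (0 < rdim F)%N -> basis_of V e -> orthonormal g e ->
  {in e &, forall v w, v != w -> g (orth_proj g W v) (orth_proj g W w) = 0} ->
  cos (asym_angle g V W) = \prod_(v <- e) proj_norm g W v
  /\ 0 <= asym_angle g V W <= pi / 2.
Proof.
move=> dF be oe de; set c := \prod_(v <- e) _.
have [_ ge] := orthonormal_seqP _ _ oe.
have c1 : 0 <= c <= 1.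
  apply/andP; split; first by apply: prodr_ge0 => v _; apply: sqrtr_ge0.
  rewrite /c big_seq; apply: prodr_ile1 => v ve.
  by rewrite (proj_norm_unit F_laws) // ge // eqxx.
have [cK cI] := acos_unit_itv c1.
have Hc : is_asym_angle g V W (acos c).
  by split=> // S SV fS; rewrite cK (vol_proj_ratio be oe de SV fS).
have [thI] : is_asym_angle g V W (asym_angle g V W).
  by apply: (xgetPex 0 (P := [set th | is_asym_angle g V W th]%classic)); exists (acos c).
move: (asym_angle g V W) thI => th thI H.
have [u [uu su] [ou ue]] := real_basis F_laws.
have sE := size_real_basis be su.
(* The real orthonormal basis is a non-degenerate parallelotope in V, on which the defining property
   can be tested. *)
have := H (Tuple (introT eqP sE)); rewrite (vol_proj_ratio be oe de).
- move=> /(_ (real_basis_sub be)) /(_ (real_basis_rfree oe uu ou)) /eqP.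
  rewrite eqrXn2 //; first by move/eqP.
  + apply: cos_ge0_pihalf; case/andP: thI => th0 ->.
    by rewrite (le_trans _ th0) // oppr_le0 divr_ge0 // pi_ge0.
  + by case/andP: c1.
- exact: real_basis_sub.
- exact: real_basis_rfree.
Qed.

End VolumeRatio.

(** * Blades *)

Section Blades.
Variables (R : realType) (F : scalars R).
Hypothesis F_laws : scalars_laws F.
Variables (X : vectType F) (g : {dot X for sconj F}).
Local Notation real := (of_real F).
Implicit Types (v w x y : X) (e f s : seq X) (V W : {vspace X}) (A B : ext X).

Lemma ext_ipZ a b A B :
  ext_ip g (a *: A) (b *: B) = sconj F a * b * ext_ip g A B.
Proof.
rewrite mulr_sumr; apply: eq_bigr => S _; rewrite mulr_sumr; apply: eq_bigr => T _.
by rewrite !ffunE /= rmorphM [in LHS]mulrACA !mulrA.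
Qed.

Lemma ext_ip0l B : ext_ip g 0 B = 0.
Proof. by rewrite -(scale0r 0) -[B]scale1r ext_ipZ rmorph0 !mul0r. Qed.

Lemma ext_ip0r A : ext_ip g A 0 = 0.
Proof. by rewrite -(scale0r 0) -[A]scale1r ext_ipZ mulr0 mul0r. Qed.

Lemma ext_norm0 : ext_norm g 0 = 0.
Proof. by rewrite /ext_norm ext_ip0l (re_part0 F_laws) sqrtr0. Qed.

(** This puts scalars in the form [z *: wedge e] common to all blades, with e the empty basis of the
    zero space. *)
Lemma ext_scalarE (c : F) : ext_scalar X c = c *: wedge [::].
Proof.
apply/ffunP => S; rewrite !ffunE.
by case: ifP; rewrite /= /GRing.scale /= ?mulr1 ?mulr0.
Qed.

(** Expressing s in e gives a square matrix M, and every maximal minor of the coordinates of s is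
    that of e times [\det M]. *)
Lemma wedge_basis_change s e : free s -> basis_of << s >>%VS e ->
  exists z : F, wedge s = z *: wedge e.
Proof.
move=> fs be; have es : size e = size s.
  by rewrite -(size_basis (X := in_tuple e) be); apply/eqP; move: fs; rewrite /free.
pose M : 'M[F]_(size s) := \matrix_(i, j) coord (in_tuple e) (cast_ord (esym es) j) s`_i.
have sM : coordmx (size s) s = M *m coordmx (size s) e.
  apply/matrixP => i k; rewrite !mxE.
  have sie : s`_i \in <<in_tuple e>>%VS by rewrite (span_basis be) memv_span ?mem_nth.
  rewrite {1}(coord_span sie) linear_sum (reindex (cast_ord (esym es))) /=.
    by apply: eq_bigr => j _; rewrite linearZ /= !mxE.
  by apply: onW_bij; exists (cast_ord es); [apply: cast_ordKV | apply: cast_ordK].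
exists (\det M); apply/ffunP => U; rewrite ffunE !wedgeE es sM.
by case: ifP => _; rewrite ?scaler0 // sel_cols_mul det_mulmx.
Qed.

Lemma blade_spaceP A e : is_blade A -> A != 0 -> basis_of (blade_space A) e ->
  exists z : F, A = z *: wedge e.
Proof.
move=> bA A0; pose P := [set V | A != 0 /\
    exists2 v : seq X, (0 < size v)%N & A = wedge v /\ V = <<v>>%VS]%classic.
have [exP|nP] := pselect (exists V, P V).
  have := xgetPex 0%VS exP; rewrite -/(blade_space A) => -[_ [v _ [Av ->]]] be.
  by rewrite Av; apply: wedge_basis_change => //; apply: wedge_free; rewrite -Av.
(* Here A is not a product of vectors, hence is a scalar; [xget] then returns the zero space, whose
   basis e is empty. *)
have [[c Ac]|[v v0 Av]] := bA; last by case: nP; exists <<v>>%VS; split=> //; exists v.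
rewrite /blade_space xgetPN => [|V PV]; last by apply: nP; exists V.
move=> be; exists c; rewrite Ac ext_scalarE.
have := size_basis (X := in_tuple e) be; rewrite dimv0.
by case: e {be}.
Qed.

Lemma gram_det_orthonormal e : orthonormal g e -> gram_det g e e = 1.
Proof.
move=> oe; rewrite /gram_det -[RHS](det1 _ (size e)); congr (\det _).
by apply/matrixP => i j; rewrite !mxE [ip g _ _](orthonormal_nth oe) // eq_sym.
Qed.

(** Since e is orthonormal, [wedge e] has norm 1 and the norm of A is the modulus of z; thus z
    divided by its modulus is a witness for [xget]. *)
Lemma orientationP A e : orthonormal g e -> A != 0 ->
  (exists z : F, A = z *: wedge e) ->
  [/\ 0 < ext_norm g A, `|orientation g A e| = 1
    & A = (orientation g A e * real (ext_norm g A)) *: wedge e].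
Proof.
move=> oe A0 [z Az]; have z0 : z != 0.
  by apply: contraNneq A0 => z0; rewrite Az z0 scale0r.
have zE : `|z| = real (re_part `|z|) by apply: (ge0_of_real F_laws).
have nE : ext_norm g A = re_part `|z|.
  rewrite /ext_norm Az ext_ipZ ext_ip_wedge eqxx gram_det_orthonormal // mulr1.
  have r0 : 0 <= re_part `|z| by apply: (re_part_ge0 F_laws).
  move: (re_part `|z|) zE r0 => r zE r0; rewrite (conjM_normE F_laws) zE expr2.
  by rewrite -(of_realM F_laws) (re_part_of_real F_laws) -expr2 sqrtr_sqr ger0_norm.
have rz : real (ext_norm g A) = `|z| by rewrite nE -zE.
have [] : `|orientation g A e| = 1
    /\ A = (orientation g A e * real (ext_norm g A)) *: wedge e.
  apply: (xgetPex 1 (P := [set z : F |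
    `|z| = 1 /\ A = (z * real (ext_norm g A)) *: wedge e]%classic)).
  exists (z / `|z|); rewrite /= rz; split.
    by rewrite normrM normfV normr_id mulfV // normr_eq0.
  by rewrite mulfVK ?normr_eq0.
split=> //; rewrite lt_neqAle eq_sym sqrtr_ge0 andbT.
by rewrite -(of_real_eq0 F_laws) rz normr_eq0.
Qed.

(** * Angles and exterior products in a pair of associated principal bases *)

Section Principal.
Variables (V W : {vspace X}) (e f : seq X) (c : nat -> R).
Hypotheses (be : basis_of V e) (oe : orthonormal g e).
Hypotheses (bf : basis_of W f) (onf : orthonormal g f).
Hypothesis c_ge0 : forall i, (i < \dim V)%N -> (i < \dim W)%N -> 0 <= c i.
Hypothesis ef : forall i j, (i < \dim V)%N -> (j < \dim W)%N ->
  ip g e`_i f`_j = if i == j then real (c i) else 0.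

Let size_e : size e = \dim V := esym (size_basis (X := in_tuple e) be).
Let size_f : size f = \dim W := esym (size_basis (X := in_tuple f) bf).

Lemma orth_proj_principal i : (i < \dim V)%N ->
  orth_proj g W e`_i = if (i < \dim W)%N then real (c i) *: f`_i else 0.
Proof.
move=> iV; rewrite (orth_projE _ bf onf) (big_nth 0) size_f.
have gE j : (j < \dim W)%N -> g e`_i f`_j = if i == j then real (c i) else 0.
  move=> jW; rewrite -dotC [g f`_j _]ef //.
  by case: eqP; rewrite ?(conj_of_real F_laws) ?rmorph0.
rewrite big_mkord; case: ltnP => [iW|Wi].
  rewrite (bigD1 (Ordinal iW)) //= big1 ?addr0 => [|j ji].
    by rewrite gE // eqxx.
  rewrite gE // ifN ?scale0r //; apply: contra ji => /eqP ij.
  by apply/eqP/val_inj.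
apply: big1 => j _; rewrite gE // ifN ?scale0r //.
by apply: contraTneq (ltn_ord j) => <-; rewrite -leqNgt.
Qed.

(** The projections of the e_i are multiples of distinct f_i or 0, hence pairwise orthogonal, as
    [cos_asym_angle] requires. *)
Lemma cos_asym_principal : (0 < rdim F)%N ->
  cos (asym_angle g V W) = \prod_(i < \dim V) (if (i < \dim W)%N then c i else 0)
  /\ 0 <= asym_angle g V W <= pi / 2.
Proof.
move=> dF; have [|-> ?] := cos_asym_angle F_laws dF be oe (W := W).
  move=> _ _ /(nthP 0)[i + <-] /(nthP 0)[j + <-]; rewrite size_e => iV jV ij.
  rewrite !orth_proj_principal //; case: ifP => iW; last by rewrite dot0l.
  case: ifP => jW; last by rewrite dot0r.
  rewrite dotZl dotZr (orthonormal_nth onf) ?size_f //.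
  by case: (i =P j) ij => [->|_ _]; rewrite ?eqxx ?mulr0.
split=> //; rewrite (big_nth 0) size_e big_mkord; apply: eq_bigr => i _.
rewrite /proj_norm orth_proj_principal //; case: ifP => iW.
  rewrite dotZl dotZr (conj_of_real F_laws) (orthonormal_nth onf) ?size_f // eqxx mulr1.
  by rewrite -(of_realM F_laws) (re_part_of_real F_laws) -expr2 sqrtr_sqr ger0_norm ?c_ge0.
by rewrite dot0l (re_part0 F_laws) sqrtr0.
Qed.

Lemma ext_ip_principal : ext_ip g (wedge e) (wedge f) =
  if \dim V == \dim W then real (\prod_(i < \dim V) c i) else 0.
Proof.
rewrite ext_ip_wedge size_e size_f; case: eqP => // VW.
rewrite (gram_detE _ _ size_e); pose d : 'rV[F]_(\dim V) := \row_i real (c i).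
rewrite (_ : \matrix_(_, _) _ = diag_mx d).
  by rewrite det_diag (of_real_prod F_laws); apply: eq_bigr => i _; rewrite mxE.
apply/matrixP => i j; rewrite !mxE ef -?VW // eq_sym -val_eqE.
by rewrite eq_sym; case: eqP.
Qed.

End Principal.

Lemma ext_ip_principal_cos V W e f : (0 < rdim F)%N -> principal_bases g V W e f ->
  ext_ip g (wedge e) (wedge f) = real (cos (max_angle g V W)).
Proof.
move=> dF [theta [[sz _ thI] [[be oe] [bf onf] ef]]].
pose c i := cos theta`_i.
have c0 i : (i < \dim V)%N -> (i < \dim W)%N -> 0 <= c i.
  move=> iV iW; have /thI/andP[t0 t1] : theta`_i \in theta.
    by rewrite mem_nth // sz leq_min iV.
  by apply: cos_ge0_pihalf; rewrite t1 (le_trans _ t0) // oppr_le0 divr_ge0 // pi_ge0.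
(* The hypothesis [ef] with the roles of V and W exchanged, for the angle from W to V. *)
have fe i j : (i < \dim W)%N -> (j < \dim V)%N ->
    ip g f`_i e`_j = if i == j then real (c i) else 0.
  move=> iW jV; rewrite -ipC ef // eq_sym.
  by case: eqP => [->|]; rewrite ?(conj_of_real F_laws) ?rmorph0.
have [cVW VWI] := cos_asym_principal be oe bf onf c0 ef dF.
have [cWV WVI] := cos_asym_principal bf onf be oe (fun i iW iV => c0 i iV iW) fe dF.
rewrite (ext_ip_principal be bf ef) /max_angle.
have [VW|VW] := eqVneq (\dim V) (\dim W).
  (* In equal dimensions both asymmetric angles have the same cosine, so it does not matter which
     one the maximum selects. *)
  have cosE : cos (asym_angle g V W) = \prod_(i < \dim V) c i.
    by rewrite cVW; apply: eq_bigr => i _; rewrite -VW ltn_ord.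
  have cosE' : cos (asym_angle g W V) = \prod_(i < \dim V) c i.
    by rewrite cWV VW; apply: eq_bigr => i _; rewrite ltn_ord.
  by rewrite /Num.max; case: ifP => _; rewrite ?cosE ?cosE'.
suff -> : Num.max (asym_angle g V W) (asym_angle g W V) = pi / 2.
  by rewrite cos_pihalf (of_real0 F_laws).
case/andP: (VWI) => _ leVW; case/andP: (WVI) => _ leWV.
have [ltVW|ltWV|] := ltngtP (\dim V) (\dim W); last by move/eqP; rewrite (negPf VW).
  have -> : asym_angle g W V = pi / 2.
    (* The factor of index [\dim V], the first one without a partner in V, is 0. *)
    apply: cos_eq0_pihalf => //; rewrite cWV (bigD1 (Ordinal ltVW)) //= ltnn.
    exact: mul0r.
  by apply/max_idPr.
have -> : asym_angle g V W = pi / 2.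
  apply: cos_eq0_pihalf => //; rewrite cVW (bigD1 (Ordinal ltWV)) //= ltnn.
  exact: mul0r.
by apply/max_idPl.
Qed.

(** The bases are arbitrary and the norms are nonzero, so the product of relative orientation and
    cosine is the same for all choices of associated principal bases; this makes the oriented angle
    well defined. *)
Lemma ext_ip_blades A B e f : (0 < rdim F)%N ->
  is_blade A -> is_blade B -> A != 0 -> B != 0 ->
  principal_bases g (blade_space A) (blade_space B) e f ->
  [/\ ext_ip g A B = real (ext_norm g A) * real (ext_norm g B)
        * (rel_orientation g A B e f
           * real (cos (max_angle g (blade_space A) (blade_space B)))),
      `|rel_orientation g A B e f| = 1, 0 < ext_norm g A & 0 < ext_norm g B].
Proof.
move=> dF bA bB A0 B0 ef; have eE := ext_ip_principal_cos dF ef.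
have [theta [_ [[be oe] [bf onf] _]]] := ef.
have [nA oA Ae] := orientationP oe A0 (blade_spaceP bA A0 be).
have [nB oB Bf] := orientationP onf B0 (blade_spaceP bB B0 bf).
split=> //.
  rewrite {1}Ae {1}Bf ext_ipZ eE rmorphM (conj_of_real F_laws) /rel_orientation.
  ring.
have oA' : `|sconj F (orientation g A e)| * `|orientation g A e| = 1.
  by rewrite -normrM (conjM_normE F_laws) oA expr1n normr1.
by rewrite /rel_orientation normrM oB -oA oA'.
Qed.

End Blades.

(** * The real and complex scalars *)

Local Open Scope complex_scope.

Section HermitianEigenvalue.
Variable R : realType.

Lemma conjC_complex (z : R[i]) : conjC z = conjc z.
Proof. by []. Qed.

Lemma eigenvalue_complex n (M : 'M[R[i]]_n) : (0 < n)%N -> exists a, eigenvalue M a.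
Proof.
move=> n0; have /closed_rootP[a Ma] : size (char_poly M) != 1%N.
  by rewrite size_char_poly -lt0n.
by exists a; rewrite eigenvalue_root_char.
Qed.

(** For an eigenvector v, the number v M v^* equals a N, where N = v v^* is real and nonzero; it is
    its own conjugate because M is Hermitian. *)
Lemma hermitian_eigenvalue_real n (M : 'M[R[i]]_n) a :
  (forall i j, conjc (M j i) = M i j) -> eigenvalue M a -> conjc a = a.
Proof.
move=> Mh /eigenvalueP[v vM v0].
pose N := \sum_i v 0 i * conjc (v 0 i).
have Nj : \sum_j (v *m M) 0 j * conjc (v 0 j) = a * N.
  by rewrite vM mulr_sumr; apply: eq_bigr => j _; rewrite mxE mulrA.
have Nc : conjc N = N.
  by rewrite rmorph_sum; apply: eq_bigr => i _; rewrite rmorphM /= conjcK mulrC.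
have N0 : N != 0.
  apply: contraNneq v0 => N0; apply/eqP/rowP => i; rewrite mxE.
  have /psumr_eq0P/(_ N0)/(_ i isT)/eqP : forall i : 'I_n, true -> 0 <= v 0 i * conjc (v 0 i).
    by move=> j _; apply: mulcJ_ge0.
  by rewrite mulf_eq0 conjc_eq0 orbb => /eqP.
apply: (mulIf N0); rewrite -Nj -{1}Nc -rmorphM -Nj rmorph_sum.
under eq_bigr do rewrite rmorphM /= conjcK mxE rmorph_sum mulr_suml.
under [RHS]eq_bigr do rewrite mxE mulr_suml.
rewrite exchange_big; apply: eq_bigr => i _; apply: eq_bigr => j _ /=.
by rewrite rmorphM /= Mh; ring.
Qed.

(** Over the complex numbers an eigenvalue exists; being real, it is a root of the real
    characteristic polynomial. *)
Lemma symmetric_eigenvalue n (M : 'M[R]_n) : (0 < n)%N ->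
  (forall i j, M j i = M i j) -> exists a, eigenvalue M a.
Proof.
move=> n0 Ms; pose MC := map_mx (real_complex R) M.
have [a aM] := eigenvalue_complex MC n0.
have ac : conjc a = a.
  by apply: (hermitian_eigenvalue_real _ aM) => i j; rewrite !mxE Ms conjc_real.
have aE : a = (complex.Re a)%:C.
  case: a {aM} ac => x y [] /esym/eqP; rewrite -subr_eq0 opprK -mulr2n mulrn_eq0 /=.
  by move=> /eqP->.
exists (complex.Re a); rewrite eigenvalue_root_char.
by rewrite -(fmorph_root (real_complex R)) map_char_poly -eigenvalue_root_char /= -aE.
Qed.

End HermitianEigenvalue.

Lemma real_scalars_laws (R : realType) : scalars_laws (real_scalars R).
Proof.
split=> //=.
- by move=> x; rewrite real_normK ?num_real // expr2.
- by exists idfun.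
- exists [:: 1] => //=; split.
    by move=> a b; rewrite !inE => /eqP-> /eqP->; rewrite mulr1 eqxx.
  by move=> x; rewrite big_seq1 mul1r mulr1.
- by move=> n M n0; apply: symmetric_eigenvalue.
Qed.

Lemma complex_scalars_laws (R : realType) : scalars_laws (complex_scalars R).
Proof.
split=> //=.
- by move=> x; rewrite normCK mulrC.
- by exists (real_complex R).
- by move=> a; rewrite conjC_complex conjc_real.
- by move=> [a b] [c d].
- by move=> a [x y] /=; rewrite mul0r subr0.
- by move=> [x y] /=; rewrite lecE /= => /andP[/eqP-> _].
- by move=> a; rewrite ler0c.
- exists [:: 1; 'i] => /=; first by rewrite inE eq_complex /= oner_eq0.
  split.
    move=> a b; rewrite !inE => /orP[] /eqP-> /orP[] /eqP-> /=.
    - by rewrite eqxx /=; ring.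
    - by case: eqP => [[/eqP]|_]; [rewrite oner_eq0 | rewrite /=; ring].
    - by case: eqP => [[/eqP]|_]; [rewrite eq_sym oner_eq0 | rewrite /=; ring].
    - by rewrite eqxx /=; ring.
  move=> [x y]; rewrite !big_cons big_nil /=.
  apply/eqP; rewrite eq_complex /=; apply/andP; split; apply/eqP; ring.
- by move=> n M n0 _; apply: eigenvalue_complex.
Qed.

(** * Oriented angles *)

Section ComplexCosine.
Variable R : realType.
Implicit Types z w : R[i].

Lemma cexpN z : cexp (- z) = (cexp z)^-1.
Proof.
suff : cexp z * cexp (- z) = 1.
  move=> zz; have z0 : cexp z != 0.
    by apply: contraTneq (oner_neq0 R[i]) => z0; rewrite -zz z0 mul0r eqxx.
  by apply: (mulfI z0); rewrite zz mulfV.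
case: z => x y; rewrite /cexp /= cosN sinN mulrACA -rmorphM /= -expRD subrr expR0.
rewrite mul1r; apply/eqP; rewrite eq_complex /= mulrN opprK -!expr2 cos2Dsin2 eqxx /=.
by rewrite mulrN mulrC addNr.
Qed.

Lemma cexp_surj w : w != 0 -> exists z, cexp z = w.
Proof.
case: w => a b w0; pose r := Num.sqrt (a ^+ 2 + b ^+ 2).
have ab0 : 0 < a ^+ 2 + b ^+ 2.
  rewrite lt_neqAle addr_ge0 ?sqr_ge0 // andbT eq_sym.
  apply: contra w0; rewrite paddr_eq0 ?sqr_ge0 // !sqrf_eq0 => /andP[/eqP-> /eqP->].
  by rewrite eq_complex /= !eqxx.
have r0 : 0 < r by rewrite sqrtr_gt0.
have r2 : r ^+ 2 = a ^+ 2 + b ^+ 2 by rewrite sqr_sqrtr // ltW.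
have ar1 : 1 - (a / r) ^+ 2 = (b / r) ^+ 2.
  by rewrite !expr_div_n r2; field; rewrite gt_eqF.
have arI : -1 <= a / r <= 1.
  by rewrite -ler_norml -(expr_le1 (n := 2)) // real_normK ?num_real // -subr_ge0 ar1 sqr_ge0.
pose t := acos (a / r).
have tc : cos t = a / r by rewrite acosK // in_itv.
have ts : sin t = `|b| / r.
  by rewrite sin_acos // ar1 sqrtr_sqr normrM normfV (gtr0_norm r0).
(* The arccosine has nonnegative sine, so the argument takes the sign of b. *)
pose s := if 0 <= b then t else - t.
have sc : cos s = a / r by rewrite /s; case: ifP; rewrite ?cosN tc.
have ss : sin s = b / r.
  rewrite /s; case: ifPn => [b0|]; first by rewrite ts ger0_norm.
  by rewrite -ltNge => b0; rewrite sinN ts ltr0_norm // mulNr opprK.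
exists (ln r +i* s); rewrite /cexp /= lnK ?posrE // sc ss.
apply/eqP; rewrite eq_complex /= !mul0r subr0 addr0.
have rN0 : r != 0 by rewrite gt_eqF.
by rewrite ![r * (_ / r)]mulrC !divfK // !eqxx.
Qed.

(** With q a square root of w^2 - 1, the numbers w + q and w - q are inverse to each other and have
    mean w; it suffices to make w + q an exponential. *)
Lemma ccos_surj w : exists z, ccos z = w.
Proof.
pose q := sqrtc (w ^+ 2 - 1); have q2 : q ^+ 2 = w ^+ 2 - 1 by apply: sqr_sqrtc.
have wq : (w + q) * (w - q) = 1.
  by rewrite -[LHS]/((w + q) * (w - q)) mulrC -subr_sqr q2; ring.
have [|z zE] := @cexp_surj (w + q).
  by apply: contraTneq (oner_neq0 R[i]) => w0; rewrite -wq w0 mul0r eqxx.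
exists (- 'i * z); rewrite /ccos.
have -> : 'i * (- 'i * z) = z.
  by rewrite mulrA mulrN -expr2 sqr_i opprK mul1r.
rewrite cexpN zE.
have -> : (w + q)^-1 = w - q.
  have wq0 : w + q != 0.
    by apply: contraTneq (oner_neq0 R[i]) => w0; rewrite -wq w0 mul0r eqxx.
  by apply: (mulfI wq0); rewrite wq mulfV.
by field.
Qed.

End ComplexCosine.

Section OrientedAngle.
Variable R : realType.

Lemma ext_ip_real_angle (X : vectType (real_scalars R))
    (g : {dot X for sconj (real_scalars R)}) (A B : ext X) :
  is_blade A -> is_blade B ->
  ext_ip g A B = ext_norm g A * ext_norm g B * cos (real_oriented_angle g A B).
Proof.
move=> bA bB; have laws := real_scalars_laws R.
have [->|A0] := eqVneq A 0; first by rewrite ext_ip0l (ext_norm0 laws) !mul0r.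
have [->|B0] := eqVneq B 0; first by rewrite ext_ip0r (ext_norm0 laws) mulr0 mul0r.
have core := ext_ip_blades laws (g := g) (A := A) (B := B) isT bA bB A0 B0.
have [e0 [f0 ef0]] := exists_principal_bases laws g (blade_space A) (blade_space B).
pose r e f : R :=
  rel_orientation g A B e f * cos (max_angle g (blade_space A) (blade_space B)).
have rE e f : principal_bases g (blade_space A) (blade_space B) e f ->
    ext_ip g A B = ext_norm g A * ext_norm g B * r e f by case/core.
have [_ o1 nA nB] := core _ _ ef0.
(* The relative orientation has modulus 1, so this value is the cosine of an angle in [0, pi]. *)
have r1 : -1 <= r e0 f0 <= 1.
  by rewrite -ler_norml normrM [`|_|]o1 mul1r ler_norml cos_geN1 cos_le1.
have nAB : ext_norm g A * ext_norm g B != 0 by rewrite mulf_neq0 // gt_eqF.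
rewrite (rE _ _ ef0); congr (_ * _).
have [] : 0 <= real_oriented_angle g A B <= pi /\ forall e f,
    principal_bases g (blade_space A) (blade_space B) e f ->
    cos (real_oriented_angle g A B) = r e f.
  apply: (xgetPex 0 (P := [set phi : R | 0 <= phi <= pi /\ forall e f : seq X,
    principal_bases g (blade_space A) (blade_space B) e f -> cos phi = r e f]%classic)).
  exists (acos (r e0 f0)); split; first by rewrite acos_ge0 // acos_lepi.
  (* For other principal bases the value is the same: both equal the inner product after
     multiplication by the nonzero norms. *)
  move=> e f ef; rewrite acosK ?in_itv //.
  by apply: (mulfI nAB); rewrite -!rE.
by move=> _ /(_ _ _ ef0)->.
Qed.

Lemma ext_ip_complex_angle (X : vectType (complex_scalars R))
    (g : {dot X for sconj (complex_scalars R)}) (A B : ext X) :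
  is_blade A -> is_blade B ->
  ext_ip g A B = (ext_norm g A)%:C * (ext_norm g B)%:C
                 * ccos (complex_oriented_angle g A B).
Proof.
move=> bA bB; have laws := complex_scalars_laws R.
have [->|A0] := eqVneq A 0; first by rewrite ext_ip0l (ext_norm0 laws) !mul0r.
have [->|B0] := eqVneq B 0; first by rewrite ext_ip0r (ext_norm0 laws) mulr0 mul0r.
have core := ext_ip_blades laws (g := g) (A := A) (B := B) isT bA bB A0 B0.
have [e0 [f0 ef0]] := exists_principal_bases laws g (blade_space A) (blade_space B).
pose r e f : R[i] :=
  rel_orientation g A B e f * (cos (max_angle g (blade_space A) (blade_space B)))%:C.
have rE e f : principal_bases g (blade_space A) (blade_space B) e f ->
    ext_ip g A B = (ext_norm g A)%:C * (ext_norm g B)%:C * r e f by case/core.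
have [_ _ nA nB] := core _ _ ef0.
have nAB : (ext_norm g A)%:C * (ext_norm g B)%:C != 0 :> R[i].
  by rewrite -rmorphM /= fmorph_eq0 mulf_neq0 // gt_eqF.
rewrite (rE _ _ ef0); congr (_ * _).
have H : forall e f,
    principal_bases g (blade_space A) (blade_space B) e f ->
    ccos (complex_oriented_angle g A B) = r e f.
  apply: (xgetPex 0 (P := [set phi : R[i] | forall e f : seq X,
    principal_bases g (blade_space A) (blade_space B) e f -> ccos phi = r e f]%classic)).
  (* Surjectivity of the complex cosine provides an angle for one pair of bases, and cancelling the
     norms extends it to all pairs. *)
  have [z zE] := ccos_surj (r e0 f0); exists z => e f ef; rewrite zE.
  by apply: (mulfI nAB); rewrite -!rE.
by rewrite (H _ _ ef0).
Qed.

End OrientedAngle.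

Theorem theoremA1 (R : realType) :
  (forall (X : vectType (real_scalars R))
          (g : {dot X for sconj (real_scalars R)}) (A B : ext X),
     is_blade A -> is_blade B ->
     ext_ip g A B
     = ext_norm g A * ext_norm g B * cos (real_oriented_angle g A B))
  /\
  (forall (X : vectType (complex_scalars R))
          (g : {dot X for sconj (complex_scalars R)}) (A B : ext X),
     is_blade A -> is_blade B ->
     ext_ip g A B
     = (ext_norm g A)%:C * (ext_norm g B)%:C
       * ccos (complex_oriented_angle g A B)).
Proof.
split=> X g A B; [exact: ext_ip_real_angle | exact: ext_ip_complex_angle].
Qed.
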